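(* Let $f\in L_2(\mathbb{R}^d)$ be admissible, $L\in\mathbb{Z}^d\setminus\{0\}$ and $\lambda>0$. Then $$\lim_{\lambda\to\infty}\mathrm{UP}_L^{\mathbb{T}^d}(f_\lambda^{\mathrm{per}})=\mathrm{UP}_L(f).$$
   Context: Notation: $d\in\mathbb{N}$; $\langle x,y\rangle$ and $\|x\|$ are the Euclidean inner product and norm on $\mathbb{R}^d$; $\mathbb{T}^d=\mathbb{R}^d/\mathbb{Z}^d$, identified with $[-1/2,1/2)^d$; functions are complex-valued; $\|f\|_2$ and $\langle f,g\rangle=\int_{\mathbb{R}^d}f\overline g$ are the norm and inner product of $L_2(\mathbb{R}^d)$, while $\|f\|_{\mathbb{T}^d}$ and $\langle f,g\rangle_{\mathbb{T}^d}=\int_{\mathbb{T}^d}f\overline g$ are those of $L_2(\mathbb{T}^d)$. $H^1(\mathbb{R}^d)$ (resp. $H^1(\mathbb{T}^d)$) is the space of $L_2$ functions all of whose first-order derivatives are in $L_2$. The Fourier transform is $\widehat f(\xi)=\int_{\mathbb{R}^d}f(x)\mathrm{e}^{-2\pi\mathrm{i}\langle x,\xi\rangle}\,\mathrm{d}x$. The directional derivative is $\frac{\partial f}{\partial L}=\sum_{j=1}^dL_j\frac{\partial f}{\partial x_j}$. Non-periodic case. $\mathcal{A}_Lf(x)=2\pi\langle L,x\rangle f(x)$, $\mathcal{B}_Lf(x)=\frac{\mathrm{i}}{2\pi}\frac{\partial f}{\partial L}(x)$, with domains $\mathcal{D}(\mathcal{A}_L)=\{f\in L_2(\mathbb{R}^d):\int\|x\|^2|f(x)|^2\mathrm{d}x<\infty\}$,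 $\mathcal{D}(\mathcal{B}_L)=H^1(\mathbb{R}^d)$; $\Delta(\mathcal{A},f)=\|\mathcal{A}f\|_2^2-\frac{|\langle\mathcal{A}f,f\rangle|^2}{\|f\|_2^2}$; and for non-zero $f\in\mathcal{D}(\mathcal{A}_L)\cap\mathcal{D}(\mathcal{B}_L)$, $$\mathrm{UP}_L(f)=\frac{\Delta(\mathcal{A}_L,f)\Delta(\mathcal{B}_L,f)}{\|L\|^4\|f\|_2^4}.$$ Periodic case. For $L\in\mathbb{Z}^d\setminus\{0\}$, $\mathcal{A}_L^{\mathbb{T}^d}f(x)=\mathrm{e}^{2\pi\mathrm{i}\langle L,x\rangle}f(x)$ on $L_2(\mathbb{T}^d)$ and $\mathcal{B}_L^{\mathbb{T}^d}f(x)=\frac{\mathrm{i}}{2\pi}\frac{\partial f}{\partial L}(x)$ on $H^1(\mathbb{T}^d)$. For $f\in H^1(\mathbb{T}^d)$ with $\langle\mathcal{A}_L^{\mathbb{T}^d}f,f\rangle_{\mathbb{T}^d}\ne0$, $$\mathrm{UP}_L^{\mathbb{T}^d}(f)=\frac1{\|L\|^4}\left(\frac{\|f\|_{\mathbb{T}^d}^4}{|\langle\mathcal{A}_L^{\mathbb{T}^d}f,f\rangle_{\mathbb{T}^d}|^2}-1\right)\left(\frac{\|\mathcal{B}_L^{\mathbb{T}^d}f\|_{\mathbb{T}^d}^2}{\|f\|_{\mathbb{T}^d}^2}-\frac{|\langle\mathcal{B}_L^{\mathbb{T}^d}f,f\rangle_{\mathbb{T}^d}|^2}{\|f\|_{\mathbb{T}^d}^4}\right).$$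 Admissibility. A non-zero $f\in L_2(\mathbb{R}^d)$ is admissible if $f$ is continuously differentiable, $f\in H^1(\mathbb{R}^d)$, $\widehat f\in H^1(\mathbb{R}^d)$, and there are constants $C_1,C_2>0$, $\beta>d$, $\gamma>\max\{\frac d2+1,d\}$ such that $|f(x)|\le\frac{C_1}{\|x\|^\gamma}$ and $\left|\frac{\partial f}{\partial x_j}(x)\right|\le\frac{C_2}{\|x\|^\beta}$, $j=1,\dots,d$, for all $x\in\mathbb{R}^d$ (with $x\neq0$). Periodization. $f_\lambda^{\mathrm{per}}(x)=\sqrt{\lambda^d}\sum_{k\in\mathbb{Z}^d}f(\lambda(x+k))$. The limit is understood for $\lambda$ large enough that $\mathrm{UP}_L^{\mathbb{T}^d}(f_\lambda^{\mathrm{per}})$ is defined. *)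

(* Defs.v *)
From HB Require Import structures.
From mathcomp Require Import all_boot all_order all_algebra.
From mathcomp Require Import complex.
From mathcomp Require Import all_classical all_reals all_analysis.

Set Implicit Arguments.
Unset Strict Implicit.
Unset Printing Implicit Defensive.

Import Order.TTheory GRing.Theory Num.Theory.
Import numFieldNormedType.Exports.

Local Open Scope classical_set_scope.
Local Open Scope ring_scope.

(** * Lebesgue measure on R^n

    'rV[R]_n carries the sigma-algebra generated by the coordinates, i.e. the
    Borel sigma-algebra, and [lebesgue_rV n] is the n-fold product of the
    one-dimensional Lebesgue measure; see [lebesgue_rV_box]. *)

Definition measure_rV_display : measure_display -> measure_display.
Proof. exact. Qed.

Section measurable_rV.
Context {d} {T : measurableType d}.
Variable n : nat.

Definition rV_coord (i : 'I_n) (x : 'rV[T]_n) : T := x ord0 i.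

Let rV_set0 : g_sigma_preimage rV_coord set0.
Proof. exact: sigma_algebra0. Qed.

Let rV_setC A : g_sigma_preimage rV_coord A -> g_sigma_preimage rV_coord (~` A).
Proof. exact: sigma_algebraC. Qed.

Let rV_bigcup (F : _^nat) : (forall i, g_sigma_preimage rV_coord (F i)) ->
  g_sigma_preimage rV_coord (\bigcup_i (F i)).
Proof. exact: sigma_algebra_bigcup. Qed.

HB.instance Definition _ := @isMeasurable.Build (measure_rV_display d)
  'rV[T]_n (g_sigma_preimage rV_coord) rV_set0 rV_setC rV_bigcup.

Lemma measurable_rV_coord (i : 'I_n) :
  measurable_fun [set: 'rV[T]_n] (rV_coord i).
Proof.
move=> _ Y mY; rewrite setTI; apply: sub_sigma_algebra => /=.
rewrite -bigcup_seq/=; exists i => /=; first by rewrite mem_index_enum.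
by exists Y => //; rewrite setTI.
Qed.

Lemma measurable_fun_rVP d1 (T1 : measurableType d1) (f : T1 -> 'rV[T]_n) :
  measurable_fun [set: T1] f <->
  forall i, measurable_fun [set: T1] (rV_coord i \o f).
Proof.
split=> [mf i|mf]; first exact: (measurableT_comp (measurable_rV_coord i) mf).
move=> _ A; rewrite setTI.
suff : g_sigma_preimage rV_coord `<=` [set B | measurable (f @^-1` B)] by apply.
apply: smallest_sub.
  split => [|B mB|F mF] /=.
  - by rewrite preimage_set0.
  - by rewrite setTD -preimage_setC; exact: measurableC.
  - by rewrite preimage_bigcup; exact: bigcupT_measurable.
move=> B; rewrite -bigcup_seq => -[i _ [C mC <-]] /=.
by rewrite setTI -comp_preimage -[X in measurable X]setTI; exact: mf.
Qed.

End measurable_rV.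

Section cons_rV.
Context {R : realType}.
Variable n : nat.

Definition cons_rV (p : measurableTypeR R * 'rV[R]_n) : 'rV[R]_n.+1 :=
  \row_i (if unlift ord0 i is Some j then p.2 ord0 j else p.1).

Definition uncons_rV (x : 'rV[R]_n.+1) : measurableTypeR R * 'rV[R]_n :=
  (x ord0 ord0, \row_j x ord0 (lift ord0 j)).

Lemma cons_rVK : cancel cons_rV uncons_rV.
Proof.
move=> [a v]; congr pair => /=; first by rewrite mxE unlift_none.
by apply/rowP => j; rewrite !mxE liftK.
Qed.

Lemma uncons_rVK : cancel uncons_rV cons_rV.
Proof.
move=> x; apply/rowP => i; rewrite mxE /=.
by case: unliftP => [j ->|->]; rewrite ?mxE.
Qed.

Lemma measurable_cons_rV : measurable_fun [set: measurableTypeR R * 'rV[R]_n] cons_rV.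
Proof.
apply/measurable_fun_rVP => i.
case: (unliftP ord0 i) => [j|] ->.
  rewrite (_ : _ \o _ = rV_coord j \o snd).
    exact: (measurableT_comp (measurable_rV_coord j) measurable_snd).
  by apply/funext => p; rewrite /rV_coord /= mxE liftK.
rewrite (_ : _ \o _ = fst); first exact: measurable_fst.
by apply/funext => p; rewrite /rV_coord /= mxE unlift_none.
Qed.

Lemma measurable_uncons_rV : measurable_fun [set: 'rV[R]_n.+1] uncons_rV.
Proof.
apply: measurable_fun_pair; first exact: (measurable_rV_coord ord0).
apply/measurable_fun_rVP => j.
rewrite (_ : _ \o _ = rV_coord (lift ord0 j)); first exact: measurable_rV_coord.
by apply/funext => x; rewrite /rV_coord /= mxE.
Qed.

End cons_rV.

HB.instance Definition _ (R : realType) n :=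
  isMeasurableFun.Build _ _ _ _ (@cons_rV R n) (@measurable_cons_rV R n).

Section lebesgue_rV.
Context {R : realType}.
Local Open Scope ereal_scope.

Section step.
Variables (n : nat) (mu : {sigma_finite_measure set 'rV[R]_n -> \bar R}).

Let step : set 'rV[R]_n.+1 -> \bar R :=
  pushforward (lebesgue_measure \x mu) (@cons_rV R n).

Let step0 : step set0 = 0. Proof. exact: measure0. Qed.

Let step_ge0 A : 0 <= step A. Proof. exact: measure_ge0. Qed.

Let step_sigma_additive : semi_sigma_additive step.
Proof. exact: measure_semi_sigma_additive. Qed.

HB.instance Definition _ := isMeasure.Build _ _ _ step
  step0 step_ge0 step_sigma_additive.

Let step_sigma_finite : sigma_finite setT step.
Proof.
have /sigma_finiteP[F [TF ndF Foo]] :=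
  sigma_finiteT (@lebesgue_measure R).
have /sigma_finiteP[G [TG ndG Goo]] := sigma_finiteT mu.
exists (fun k => @uncons_rV R n @^-1` (F k `*` G k)).
  rewrite -preimage_bigcup (_ : \bigcup_k _ = setT) ?preimage_setT//.
  apply/seteqP; split => // -[x y] _.
  have [k _ Fk] : (\bigcup_k F k) x by rewrite -TF.
  have [l _ Gl] : (\bigcup_k G k) y by rewrite -TG.
  exists (maxn k l) => //; split => /=.
    by move: Fk; exact/subsetPset/ndF/leq_maxl.
  by move: Gl; exact/subsetPset/ndG/leq_maxr.
move=> k; have [mF ltF] := Foo k; have [mG ltG] := Goo k; split.
  rewrite -[X in measurable X]setTI.
  by apply: measurable_uncons_rV => //; exact: measurableX.
rewrite /step /pushforward -comp_preimage (_ : _ \o _ = id); last first.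
  by apply/funext => p; rewrite /= cons_rVK.
by rewrite preimage_id product_measure1E// lte_mul_pinfty// ge0_fin_numE.
Qed.

HB.instance Definition _ := Measure_isSigmaFinite.Build _ _ _ step
  step_sigma_finite.

Definition lebesgue_rV_step :
  {sigma_finite_measure set 'rV[R]_n.+1 -> \bar R} := step.

End step.

Fixpoint lebesgue_rV n : {sigma_finite_measure set 'rV[R]_n -> \bar R} :=
  if n is n'.+1 then lebesgue_rV_step (lebesgue_rV n')
  else dirac (0%R : 'rV[R]_0).

Lemma lebesgue_rV_box n (a b : 'rV[R]_n) :
  (forall i, (a ord0 i <= b ord0 i)%R) ->
  lebesgue_rV n [set x | forall i, (a ord0 i <= x ord0 i < b ord0 i)%R] =
  (\prod_(i < n) (b ord0 i - a ord0 i)%R)%:E.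
Proof.
elim: n => [|n IH] in a b *.
  move=> _; rewrite big_ord0 /= diracE mem_set//=.
  by case.
move=> ab; rewrite big_ord_recl EFinM /= /pushforward.
rewrite (_ : _ @^-1` _ = `[a ord0 ord0, b ord0 ord0[ `*`
   [set x : 'rV[R]_n | forall i, ((\row_j a ord0 (lift ord0 j)) ord0 i <=
   x ord0 i < (\row_j b ord0 (lift ord0 j)) ord0 i)%R]); last first.
  apply/seteqP; split => [[x v]/= H|[x v] /= [H1 H2] i].
    split=> [|i]; first by have := H ord0; rewrite mxE unlift_none in_itv.
    by have := H (lift ord0 i); rewrite !mxE liftK.
  rewrite mxE; case: unliftP => [j ->|->]; last by move: H1; rewrite in_itv.
  by have := H2 j; rewrite !mxE.
rewrite product_measure1E//; last first.
  rewrite (_ : mkset _ = \bigcap_(i in [set: 'I_n])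
    rV_coord i @^-1` `[a ord0 (lift ord0 i), b ord0 (lift ord0 i)[%classic).
    apply: fin_bigcap_measurable => // i _.
    rewrite -[X in measurable X]setTI.
    exact: measurable_rV_coord.
  apply/seteqP; split => v /= H i; last by have := H i I; rewrite !mxE /= in_itv.
  by move=> _; have := H i; rewrite !mxE /= in_itv.
rewrite IH; last by move=> i; rewrite !mxE.
rewrite /= lebesgue_measure_itv /= lte_fin.
under eq_bigr do rewrite !mxE.
by case: ltP (ab ord0) => // ba ab0; rewrite (le_anti (introT andP (conj ab0 ba))) subrr.
Qed.

End lebesgue_rV.
Arguments lebesgue_rV {R} n.

Local Open Scope complex_scope.
Local Notation normc := ComplexField.Normc.normc.

(** * Functions on R^d and on the torus

    Functions on T^d are represented by Z^d-periodic functions on R^d,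
    integrated over the fundamental cell [-1/2,1/2)^d.  A derivative on T^d is
    tested against smooth periodic functions, one on R^d against smooth
    compactly supported ones. *)

Section euclidean.
Context {R : realType} {d : nat}.
Implicit Types (x y : 'rV[R]_d) (k : 'rV[int]_d).

Definition dotp x y : R := \sum_(j < d) x ord0 j * y ord0 j.

(* The norm `|x| that the library puts on 'rV[R]_d is the sup norm. *)
Definition enorm x : R := Num.sqrt (dotp x x).

Definition rV_of_int k : 'rV[R]_d := map_mx intr k.

Definition cell : set 'rV[R]_d :=
  [set x | forall j, - 2^-1 <= x ord0 j < 2^-1].

Definition periodic (T : Type) (f : 'rV[R]_d -> T) :=
  forall x k, f (x + rV_of_int k) = f x.

Definition expi (t : R) : R[i] := cos t +i* sin t.

End euclidean.

Section complex_integration.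
Context {R : realType} {d : nat}.
Implicit Types (D : set 'rV[R]_d) (f g : 'rV[R]_d -> R[i]).

Definition Re_fun f : 'rV[R]_d -> R := fun x => complex.Re (f x).
Definition Im_fun f : 'rV[R]_d -> R := fun x => complex.Im (f x).

Definition cintegral D f : R[i] :=
  (\int[lebesgue_rV d]_(x in D) Re_fun f x) +i*
  (\int[lebesgue_rV d]_(x in D) Im_fun f x).

Definition in_L2 D f :=
  [/\ measurable_fun D (Re_fun f), measurable_fun D (Im_fun f) &
      (\int[lebesgue_rV d]_(x in D) ((normc (f x)) ^+ 2)%:E < +oo)%E].

Definition L2inner D f g : R[i] := cintegral D (fun x => f x * (g x)^*).

Definition L2norm D f : R :=
  Num.sqrt (\int[lebesgue_rV d]_(x in D) (normc (f x)) ^+ 2).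

(* The integral formula, for integrable f. *)
Definition fourier f : 'rV[R]_d -> R[i] := fun xi =>
  cintegral setT (fun x => f x * expi (- (2 * pi * dotp x xi))).

End complex_integration.

Section derivatives.
Context {R : realType} {d : nat}.
Implicit Types (u phi : 'rV[R]_d -> R) (f g : 'rV[R]_d -> R[i]) (j : 'I_d).

Definition basis_vec j : 'rV[R]_d := delta_mx ord0 j.

Definition rpartial j u : 'rV[R]_d -> R := fun x => 'D_(basis_vec j) u x.

Definition rC1 u := forall j,
  (forall x, derivable u x (basis_vec j)) /\ continuous (rpartial j u).

Definition smooth u := forall s : seq 'I_d, rC1 (foldr rpartial u s).

Definition cpartial j f : 'rV[R]_d -> R[i] := fun x =>
  rpartial j (Re_fun f) x +i* rpartial j (Im_fun f) x.

Definition cC1 f := rC1 (Re_fun f) /\ rC1 (Im_fun f).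

(* Real-valued test functions suffice, both sides being linear in phi. *)
Definition weak_partial (D : set 'rV[R]_d) (test : set ('rV[R]_d -> R))
    j f g :=
  forall phi, test phi ->
    cintegral D (fun x => f x * (rpartial j phi x)%:C) =
    - cintegral D (fun x => g x * (phi x)%:C).

Definition L2_weak_partial D test j f g :=
  in_L2 D g /\ weak_partial D test j f g.

Definition in_H1 D test f :=
  in_L2 D f /\ forall j, exists g, L2_weak_partial D test j f g.

(* A weak derivative is determined up to a null set only; the classical
   derivative is the representative chosen whenever f is of class C^1. *)
Definition partial D test j f : 'rV[R]_d -> R[i] :=
  if `[< cC1 f >] then cpartial j f
  else xget (fun=> 0) [set g | L2_weak_partial D test j f g].

Definition dderiv D test (L : 'rV[R]_d) f : 'rV[R]_d -> R[i] := fun x =>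
  \sum_(j < d) (L ord0 j)%:C * partial D test j f x.

Definition test_Rd : set ('rV[R]_d -> R) :=
  [set phi | smooth phi /\ compact (closure [set x | phi x != 0])].

Definition test_Td : set ('rV[R]_d -> R) :=
  [set phi | smooth phi /\ periodic phi].

Definition in_H1_Rd f := in_H1 setT test_Rd f.

Definition in_H1_Td f := periodic f /\ in_H1 cell test_Td f.

End derivatives.

(** * Uncertainty products *)

Section uncertainty.
Context {R : realType} {d : nat}.
Implicit Types (f : 'rV[R]_d -> R[i]).

Definition opA (L : 'rV[R]_d) f : 'rV[R]_d -> R[i] := fun x =>
  (2 * pi * dotp L x)%:C * f x.

Definition opB (L : 'rV[R]_d) f : 'rV[R]_d -> R[i] := fun x =>
  (0 +i* (2 * pi)^-1) * dderiv setT test_Rd L f x.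

Definition domA f :=
  in_L2 setT f /\
  (\int[lebesgue_rV d]_x (enorm x ^+ 2 * (normc (f x)) ^+ 2)%:E < +oo)%E.

Definition nonzero f :=
  ~ {ae lebesgue_rV d, forall x, f x = 0}.

Definition Delta (A : ('rV[R]_d -> R[i]) -> 'rV[R]_d -> R[i]) f : R :=
  L2norm setT (A f) ^+ 2
  - normc (L2inner setT (A f) f) ^+ 2 / L2norm setT f ^+ 2.

Definition UP_defined f := [/\ nonzero f, domA f & in_H1_Rd f].

Definition UP (L : 'rV[R]_d) f : R :=
  Delta (opA L) f * Delta (opB L) f / (enorm L ^+ 4 * L2norm setT f ^+ 4).

Definition opA_Td (L : 'rV[int]_d) f : 'rV[R]_d -> R[i] := fun x =>
  expi (2 * pi * dotp (rV_of_int L) x) * f x.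

Definition opB_Td (L : 'rV[int]_d) f : 'rV[R]_d -> R[i] := fun x =>
  (0 +i* (2 * pi)^-1) * dderiv cell test_Td (rV_of_int L) f x.

Definition UP_Td_defined (L : 'rV[int]_d) f :=
  in_H1_Td f /\ L2inner cell (opA_Td L f) f != 0.

Definition UP_Td (L : 'rV[int]_d) f : R :=
  1 / enorm (rV_of_int L : 'rV[R]_d) ^+ 4
  * (L2norm cell f ^+ 4 / normc (L2inner cell (opA_Td L f) f) ^+ 2 - 1)
  * (L2norm cell (opB_Td L f) ^+ 2 / L2norm cell f ^+ 2
     - normc (L2inner cell (opB_Td L f) f) ^+ 2 / L2norm cell f ^+ 4).

Definition admissible f :=
  [/\ nonzero f /\ in_L2 setT f, cC1 f, in_H1_Rd f, in_H1_Rd (fourier f) &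
    exists C1 C2 beta gamma : R,
      [/\ 0 < C1 /\ 0 < C2, d%:R < beta,
          Num.max (d%:R / 2 + 1) d%:R < gamma,
          forall x : 'rV[R]_d, x != 0 -> normc (f x) <= C1 / enorm x `^ gamma &
          forall (j : 'I_d) (x : 'rV[R]_d), x != 0 ->
            normc (cpartial j f x) <= C2 / enorm x `^ beta]].

(* Meaningful for absolutely summable families only. *)
Definition Zsum (a : 'rV[int]_d -> R) : R :=
  let b := EFin \o a in
  fine (\esum_(k in setT) b^\+ k)%E - fine (\esum_(k in setT) b^\- k)%E.

Definition Zsumc (a : 'rV[int]_d -> R[i]) : R[i] :=
  Zsum (fun k => complex.Re (a k)) +i* Zsum (fun k => complex.Im (a k)).

Definition periodize (lambda : R) f : 'rV[R]_d -> R[i] := fun x =>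
  (Num.sqrt (lambda ^+ d))%:C
  * Zsumc (fun k => f (lambda *: (x + rV_of_int k))).

End uncertainty.

(* Main.v *)
Require Import Defs.
From mathcomp Require Import all_boot all_order all_algebra.
From mathcomp Require Import complex.
From mathcomp Require Import all_classical all_reals all_analysis.
From mathcomp Require Import measurable_realfun ring lra.

Import Order.TTheory GRing.Theory Num.Theory.
Import numFieldNormedType.Exports.

Local Open Scope classical_set_scope.
Local Open Scope ring_scope.

(** The change of variables y = lam x turns the periodization on the unit cell
    into sqrt (lam^d) times the lattice sum of the f (y + lam k), for y in the
    dilated cell [-lam/2, lam/2)^d.  There the translates with k <> 0 are far
    away: (1 + |y|) (1 + |k|) <= 4 (1 + |y + lam k|).  If f decays like |y|^-s with
    s > d, the lattice sum therefore converges to f pointwise as lam tends to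
    infinity, and it is bounded on the dilated cell by C (1 + |y|)^-s with C
    independent of lam ([wt_lattice_translate], [lattice_sum_bound],
    [lattice_sum_cvg]).  The same holds for the partial derivatives.  Every
    integral in the periodic uncertainty product becomes an integral over the
    dilated cell whose limit is given by dominated convergence
    ([cvg_dilated_cell]); the predicate [approximates] keeps track of the
    envelopes.

    Let g be the periodization, M = |g|^2 and <A g, g> = c + i s.  From
    1 - cos t = 2 (sin (t / 2))^2 one gets
    - 2 lam^2 (M - c) -> |A f|^2, where the integrand contains the factor
      (2 lam sin (pi <L, y> / lam))^2 of quadratic growth, which the decay
      gamma > d / 2 + 1 makes up for;
    - lam s -> <A f, f>, M -> |f|^2, |B g|^2 / lam^2 -> |B f|^2 and
      <B g, g> / lam -> <B f, f>.
    Hence lam^2 (M^2 - c^2 - s^2) = lam^2 (M - c) (M + c) - (lam s)^2 tends to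
    |f|^2 Delta (A, f).  This compensates the factor lam^2 in the second half of
    the product, and the limit follows ([periodized_UP_cvg]).

    The periodic uncertainty product makes sense because g is of class C^1: the
    lattice sum is differentiated term by term, by Tannery's theorem [Zsum_cvg]
    and the mean value theorem ([periodization_rC1]).  Its classical partial
    derivatives are the weak ones by integration by parts over a cell
    ([cell_integration_by_parts]), and <A g, g> does not vanish for large lam
    since c -> |f|^2 > 0. *)

(** * Absolutely convergent sums over the integer lattice *)

Section summation.
Context {R : realType} {d : nat}.
Implicit Types a b p q M : 'rV[int]_d -> R.

Definition abs_summable a := summable [set: 'rV[int]_d] (EFin \o a).

Definition abs_total a : R := fine (\esum_(k in setT) `|a k|%:E).

Lemma abs_summable_fin a : abs_summable a ->
  \esum_(k in setT) `|a k|%:E = (abs_total a)%:E.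
Proof.
by move=> sa; rewrite /abs_total fineK//; move: sa; rewrite /abs_summable summableE.
Qed.

Lemma abs_total_ge0 a : 0 <= abs_total a.
Proof. by rewrite fine_ge0// esum_ge0. Qed.

Lemma abs_summable_le a M : abs_summable M ->
  (forall k, `|a k| <= M k) -> abs_summable a.
Proof.
move=> sM aM; apply: le_lt_trans sM; apply: le_esum => k _ /=.
by rewrite lee_fin (le_trans (aM k))// ler_norm.
Qed.

Lemma abs_total_le a M : abs_summable M ->
  (forall k, `|a k| <= M k) -> abs_total a <= abs_total M.
Proof.
move=> sM aM; have sa := abs_summable_le _ _ sM aM.
rewrite -lee_fin -!abs_summable_fin//; apply: le_esum => k _ /=.
by rewrite lee_fin (le_trans (aM k))// ler_norm.
Qed.

Lemma abs_summableD a b : abs_summable a -> abs_summable b ->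
  abs_summable (fun k => a k + b k).
Proof. exact: summableD. Qed.

Lemma abs_summableN a : abs_summable a -> abs_summable (fun k => - a k).
Proof. by rewrite /abs_summable summableN. Qed.

Lemma abs_summable_norm a : abs_summable a -> abs_summable (fun k => `|a k|).
Proof.
rewrite /abs_summable /summable => sa.
by under eq_esum do rewrite /= normr_id.
Qed.

Lemma abs_summableZ c a : abs_summable a -> abs_summable (fun k => c * a k).
Proof.
move=> sa; have: abs_summable (fun k => `|c| * `|a k|).
  rewrite /abs_summable /summable.
  under eq_esum do rewrite /= normrM !normr_id EFinM.
  apply: (@le_lt_trans _ _ (`|c|%:E * \esum_(k in setT) `|a k|%:E)%E).
    apply: ge_ereal_sup => _ [X [fX _] <-].
    rewrite -ge0_mule_fsumr; last by move=> i; rewrite lee_fin.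
    by apply: lee_wpmul2l => //; apply: ereal_sup_ubound; exists X.
  by rewrite abs_summable_fin// -EFinM ltry.
by move=> s; apply: abs_summable_le s _ => k; rewrite normrM.
Qed.

(** Any splitting into nonnegative summable parts computes the sum.  Linearity
    follows from this freedom, since positive parts are not additive. *)
Lemma Zsum_sub p q : abs_summable p -> abs_summable q ->
  (forall k, 0 <= p k) -> (forall k, 0 <= q k) ->
  Zsum (fun k => p k - q k) = abs_total p - abs_total q.
Proof.
move=> sp sq p0 q0; rewrite /Zsum.
have sB : summable [set: 'rV[int]_d] (EFin \o (fun k => p k - q k)).
  by apply: abs_summableD => //; exact: abs_summableN.
rewrite -fineB; [|by have := summable_funepos sB; rewrite summableE; under eq_esum do rewrite
    gee0_abs//|
                  by have := summable_funeneg sB; rewrite summableE; under eq_esum do rewrite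
                  gee0_abs//].
have /= := @esumB _ _ setT (EFin \o p) (EFin \o q) sp sq (fun k _ => p0 k) (fun k _ => q0 k).
move=> ->.
have h r : abs_summable r -> (forall k, 0 <= r k) ->
    (\esum_(i in setT) (EFin \o r) i = (abs_total r)%:E)%E.
  move=> sr r0; rewrite -abs_summable_fin//.
  by apply: eq_esum => k _; rewrite ger0_norm.
by rewrite !h.
Qed.

Lemma Zsum_posneg a : abs_summable a ->
  Zsum a = abs_total (fun k => Num.max (a k) 0) - abs_total (fun k => Num.max (- a k) 0).
Proof.
move=> sa; rewrite -Zsum_sub.
- by congr Zsum; apply/funext => k; case: (lerP (a k) 0) => ?; case: (lerP (- a k) 0) => ?; lra.
- apply: abs_summable_le (abs_summable_norm _ sa) _.
  by move=> k; rewrite ger0_norm ?le_max ?lexx ?orbT// ge_max ler_norm normr_ge0.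
- apply: abs_summable_le (abs_summable_norm _ sa) _.
  by move=> k; rewrite ger0_norm ?le_max ?lexx ?orbT// ge_max -normrN ler_norm normr_ge0.
- by move=> k; rewrite le_max lexx orbT.
- by move=> k; rewrite le_max lexx orbT.
Qed.

Lemma abs_summable_max a : abs_summable a -> abs_summable (fun k => Num.max (a k) 0).
Proof.
move=> sa; apply: abs_summable_le (abs_summable_norm _ sa) _.
by move=> k; rewrite ger0_norm ?le_max ?lexx ?orbT// ge_max ler_norm normr_ge0.
Qed.

Lemma abs_totalD p q : abs_summable p -> abs_summable q ->
  (forall k, 0 <= p k) -> (forall k, 0 <= q k) ->
  abs_total (fun k => p k + q k) = abs_total p + abs_total q.
Proof.
move=> sp sq p0 q0; apply: EFin_inj; rewrite EFinD -!abs_summable_fin//; last exact: abs_summableD.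
rewrite -esumD; [|by move=> *; rewrite lee_fin..].
by apply: eq_esum => k _; rewrite -EFinD !ger0_norm// addr_ge0.
Qed.

Lemma ZsumD a b : abs_summable a -> abs_summable b ->
  Zsum (fun k => a k + b k) = Zsum a + Zsum b.
Proof.
move=> sa sb.
have m0 (x : R) : 0 <= Num.max x 0 by rewrite le_max lexx orbT.
have [sa1 sb1] := (abs_summable_max _ sa, abs_summable_max _ sb).
have [sa2 sb2] := (abs_summable_max _ (abs_summableN _ sa), abs_summable_max _ (abs_summableN _
    sb)).
rewrite [Zsum a]Zsum_posneg// [Zsum b]Zsum_posneg//.
rewrite addrACA -opprD -abs_totalD// -abs_totalD// -Zsum_sub; first last;
  try (by move=> k; rewrite addr_ge0); try exact: abs_summableD.
congr Zsum; apply/funext => k.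
by case: (lerP (a k) 0) => ?; case: (lerP (- a k) 0) => ?;
   case: (lerP (b k) 0) => ?; case: (lerP (- b k) 0) => ?; lra.
Qed.

Lemma ZsumN a : Zsum (fun k => - a k) = - Zsum a.
Proof.
rewrite /Zsum opprB.
have -> : EFin \o (fun k => - a k) = (\- (EFin \o a))%E by [].
by rewrite funeposN funenegN.
Qed.

Lemma Zsum_norm a : abs_summable a -> `|Zsum a| <= abs_total a.
Proof.
move=> sa; rewrite Zsum_posneg//.
have h c : abs_summable c -> abs_total (fun k => Num.max (c k) 0) <= abs_total c.
  move=> sc; have sc' := abs_summable_norm _ sc.
  apply: (@le_trans _ _ (abs_total (fun k => `|c k|))).
    apply: abs_total_le => // k; rewrite ger0_norm ?le_max ?lexx ?orbT//.
    by rewrite ge_max ler_norm normr_ge0.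
  by rewrite /abs_total; under eq_esum do rewrite normr_id.
have h1 := h _ sa; have h2 := h _ (abs_summableN _ sa).
have e : abs_total (fun k => - a k) = abs_total a.
  by rewrite /abs_total; under eq_esum do rewrite normrN.
rewrite e in h2.
have := abs_total_ge0 (fun k => Num.max (a k) 0).
have := abs_total_ge0 (fun k => Num.max (- a k) 0).
by rewrite ler_norml => *; apply/andP; split; lra.
Qed.

Lemma ZsumZ c a : abs_summable a -> Zsum (fun k => c * a k) = c * Zsum a.
Proof.
move=> sa.
have pos r p : 0 <= r -> abs_summable p -> (forall k, 0 <= p k) ->
    abs_total (fun k => r * p k) = r * abs_total p.
  move=> r0 sp p0; apply: EFin_inj; rewrite EFinM -!abs_summable_fin//; last exact: abs_summableZ.
  apply/eqP; rewrite eq_le; apply/andP; split.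
    apply: ge_ereal_sup => _ [X [fX _] <-].
    under eq_fsbigr do rewrite ger0_norm ?mulr_ge0// EFinM.
    rewrite -ge0_mule_fsumr; last by move=> i; rewrite lee_fin.
    apply: lee_wpmul2l; rewrite ?lee_fin//; apply: ereal_sup_ubound; exists X => //.
    by apply: eq_fsbigr => i _; rewrite ger0_norm.
  have [->|r_neq0] := eqVneq r 0; first by rewrite mul0e esum_ge0.
  have r_gt0 : 0 < r by rewrite lt_neqAle eq_sym r_neq0.
  rewrite -lee_pdivlMl//; apply: ge_ereal_sup => _ [X [fX _] <-].
  rewrite lee_pdivlMl//.
  rewrite ge0_mule_fsumr//; apply: ereal_sup_ubound; exists X => //.
  by apply: eq_fsbigr => i _; rewrite normrM (ger0_norm r0) EFinM.
wlog c0 : c / 0 <= c => [H|].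
  have [/H//|/ltW c0] := leP 0 c.
  rewrite -[c]opprK mulNr -H ?oppr_ge0// -ZsumN.
  by congr Zsum; apply/funext => k; rewrite mulNr.
rewrite [Zsum a]Zsum_posneg// mulrBr -!pos//;
  try (by move=> k; rewrite le_max lexx orbT);
  try (by apply: abs_summable_max; rewrite //; exact: abs_summableN).
rewrite -Zsum_sub;
  try (by move=> k; rewrite mulr_ge0// le_max lexx orbT);
  try (by apply: abs_summableZ; apply: abs_summable_max; rewrite //; exact: abs_summableN).
congr Zsum; apply/funext => k; rewrite -mulrBr; congr *%R.
by case: (lerP (a k) 0) => ?; case: (lerP (- a k) 0) => ?; lra.
Qed.

Lemma Zsum_shift a k0 : Zsum (fun k => a (k + k0)) = Zsum a.
Proof.
have bij : set_bij [set: 'rV[int]_d] setT (fun k => k + k0).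
  split => //; first by move=> k l _ _ /addIr.
  by move=> k _; exists (k - k0) => //; rewrite subrK.
rewrite /Zsum [X in _ = fine X - _](reindex_esum _ _ _ _ bij)
  [X in _ = _ - fine X](reindex_esum _ _ _ _ bij).
by congr (fine _ - fine _); apply: eq_esum => k _; rewrite ?funeposE ?funenegE.
Qed.

Lemma Zsum_delta (c : R) : Zsum (fun k : 'rV[int]_d => if k == 0 then c else 0) = c.
Proof.
have h (r : R) : 0 <= r -> abs_summable (fun k : 'rV[int]_d => if k == 0 then r else 0)
   /\ abs_total (fun k : 'rV[int]_d => if k == 0 then r else 0) = r.
  move=> r0.
  have e : \esum_(k in [set: 'rV[int]_d]) `|if k == 0 then r else 0|%:E = r%:E.
    rewrite (esumID [set 0])// setTI setTI [X in (_ + X)%E]esum1; last first.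
      by move=> k /= /eqP/negbTE ->; rewrite normr0.
    rewrite adde0 esum_set1 ?lee_fin// eqxx ger0_norm//.
  split; last by rewrite /abs_total e.
  by rewrite /abs_summable /summable /comp e ltry.
wlog c0 : c / 0 <= c => [H|].
  have [/H//|/ltW c0] := leP 0 c.
  rewrite -[c]opprK -[in RHS](H (- c)) ?oppr_ge0// -ZsumN.
  by congr Zsum; apply/funext => k; case: ifP; rewrite ?opprK ?oppr0.
have [s e] := h _ c0; have [s0 e0] := h 0 (lexx _).
rewrite -[RHS]subr0 -[in RHS]e -[X in _ = _ - X]e0 -Zsum_sub//; try by move=> k; case: ifP.
by congr Zsum; apply/funext => k; case: ifP => _; rewrite subr0.
Qed.

(** Tannery's theorem: off a finite set of indices the terms and their limits
    are within the tail of M, and on that finite set convergence is termwise. *)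
Lemma Zsum_cvg {T : Type} (F : set_system T) {FF : ProperFilter F}
    (a : T -> 'rV[int]_d -> R) b M : abs_summable M ->
  (\forall t \near F, forall k, `|a t k| <= M k) ->
  (forall k, a t k @[t --> F] --> b k) ->
  Zsum (a t) @[t --> F] --> Zsum b.
Proof.
move=> sM aM ab.
have bM k : `|b k| <= M k.
  apply: (closed_cvg [set x | x <= M k] (@closed_le _ (M k)) _ _ (cvg_norm (ab k))).
  near=> t.
  by have /(_ k) : forall k, `|a t k| <= M k by near: t.
have M0 k : 0 <= M k by exact: le_trans (bM k).
apply/cvgrPdist_lt => e e0.
have e4 : 0 < e / 4 by rewrite divr_gt0.
have [X [fX tX]] : exists X, finite_set X /\
    (\esum_(k in ~` X) (M k)%:E <= (e / 4)%:E)%E.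
  have := abs_summable_fin _ sM.
  under eq_esum do rewrite ger0_norm//.
  move=> eM.
  have fM : (\esum_(k in [set: 'rV[int]_d]) (M k)%:E)%E \is a fin_num by rewrite eM.
  have [_ [X [fX _] <-] lX] := ub_ereal_sup_adherent e4 fM.
  exists X; split => //.
  have dec : (\esum_(k in [set: 'rV[int]_d]) (M k)%:E =
      \esum_(k in X) (M k)%:E + \esum_(k in ~` X) (M k)%:E)%E.
    by rewrite (esumID X) ?setTI// => k _; rewrite lee_fin.
  have {}lX : (\esum_(k in [set: 'rV[int]_d]) (M k)%:E - (e / 4)%:E < \sum_(k \in X) (M k)%:E)%E.
    exact: lX.
  have fsX : (\sum_(k \in X) (M k)%:E = \esum_(k in X) (M k)%:E)%E.
    by rewrite esum_fset// => k _; rewrite lee_fin.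
  move: lX fM; rewrite dec -fsX fsumEFin//.
  case: (\esum_(k in ~` X) (M k)%:E)%E => // r.
  by rewrite -EFinD lte_fin lee_fin => + _; lra.
pose S := finmap.enum_fset (fset_set X).
have h : (\sum_(k <- S) `|a t k - b k|) @[t --> F] --> (0 : R).
  elim: S => [|k s IH].
    by under eq_fun do rewrite big_nil; exact: cvg_cst.
  under eq_fun do rewrite big_cons.
  have H : a t k - b k @[t --> F] --> b k - b k by apply: cvgB => //; exact: cvg_cst.
  suff : `|a t k - b k| + \sum_(j <- s) `|a t j - b j| @[t --> F] --> `|b k - b k| + 0.
    by rewrite subrr normr0 addr0.
  by apply: cvgD => //; exact: (cvg_norm H).
move/cvgrPdist_lt : h => /(_ _ e4) h.
near=> t.
have atM : forall k, `|a t k| <= M k by near: t.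
have sa : abs_summable (a t) by exact: abs_summable_le sM atM.
have sb : abs_summable b by exact: abs_summable_le sM bM.
rewrite -ZsumN -ZsumD//; last exact: abs_summableN.
have sba : abs_summable (fun k => b k - a t k).
  by apply: abs_summableD => //; exact: abs_summableN.
apply: (le_lt_trans (Zsum_norm _ sba)).
rewrite -lte_fin -abs_summable_fin//.
rewrite (esumID X)// setTI setTI.
apply: (@le_lt_trans _ _ ((e / 4)%:E + ((e / 4)%:E + (e / 4)%:E))%E); last first.
  by rewrite -!EFinD lte_fin; lra.
apply: leeD.
  rewrite esum_fset// fsumEFin// lee_fin fsbig_finite//=.
  have : `|0 - (\sum_(k <- S) `|a t k - b k|)| < e / 4 by near: t.
  rewrite sub0r normrN ger0_norm ?sumr_ge0//.
  by under eq_bigr do rewrite distrC; exact: ltW.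
apply: (@le_trans _ _ (\esum_(k in ~` X) (M k)%:E + \esum_(k in ~` X) (M k)%:E)%E).
  rewrite -esumD; try by move=> *; rewrite lee_fin.
  apply: le_esum => k _; rewrite -EFinD lee_fin.
  by rewrite (le_trans (ler_normB _ _))// lerD.
exact: leeD.
Unshelve. all: by end_near. Qed.
End summation.

(** * Calculus along coordinate lines *)

Section coordinate_lines.
Context {R : realType} {d : nat}.
Implicit Types (u : 'rV[R]_d -> R) (x y v : 'rV[R]_d) (j : 'I_d).

Lemma coord_le_norm x j : `|x ord0 j| <= `|x|.
Proof.
rewrite [leRHS]/Num.norm /= mx_normrE; apply/bigmax_geP; right.
by exists (ord0, j).
Qed.

Lemma norm_le_coord x r : 0 <= r -> (forall j, `|x ord0 j| <= r) -> `|x| <= r.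
Proof.
move=> r0 xr; rewrite [leLHS]/Num.norm /= mx_normrE; apply/bigmax_leP; split => //.
by move=> [i j] _ /=; rewrite ord1.
Qed.

Lemma is_derive_line u x v t : derivable u (x + t *: v) v ->
  is_derive t (1 : R) (fun t : R => u (x + t *: v)) ('D_v u (x + t *: v)).
Proof.
have e : (fun h : R => h^-1 *: (((fun t => u (x + t *: v)) \o shift t) (h *: (1 : R)) - u (x +
    t *: v)))
    = (fun h : R => h^-1 *: ((u \o shift (x + t *: v)) (h *: v) - u (x + t *: v))).
  apply/funext => h /=; congr (_ *: (u _ - _)).
  by rewrite [h *: 1]mulr1 scalerDl addrCA.
move=> du; apply: DeriveDef; first by rewrite /derivable e.
by rewrite /derive e.
Qed.

Lemma MVT_line u v : (forall y, derivable u y v) -> forall x t,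
  exists2 c, `|c| <= `|t| & u (x + t *: v) - u x = t * 'D_v u (x + c *: v).
Proof.
move=> du x t; pose p (s : R) := u (x + s *: v).
have dp s : is_derive s (1 : R) p ('D_v u (x + s *: v)) by apply: is_derive_line.
have cp : continuous p.
  move=> s; apply: differentiable_continuous; apply/derivable1_diffP.
  by have [] := dp s.
have p0 : p 0 = u x by rewrite /p scale0r addr0.
have [t0|/ltW t0] := leP 0 t.
  have [c] := @MVT_segment _ p (fun s => 'D_v u (x + s *: v)) _ _ t0 (fun s _ => dp s)
      (continuous_subspaceT cp).
  rewrite in_itv /= p0 subr0 => /andP[c0 ct] e; exists c; last by rewrite e mulrC.
  by rewrite !ger0_norm.
have [c] := @MVT_segment _ p (fun s => 'D_v u (x + s *: v)) _ _ t0 (fun s _ => dp s)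
    (continuous_subspaceT cp).
rewrite in_itv /= p0 sub0r => /andP[ct c0] e; exists c.
  by rewrite !ler0_norm// lerN2.
by rewrite -opprB e mulrN opprK mulrC.
Qed.

(** Moving from x to y one coordinate at a time stays in the sup-norm ball, so
    that the mean value theorem applies to each of the d moves. *)
Lemma bounded_partials_lipschitz u x r M : (forall j y, derivable u y (basis_vec j)) ->
  (forall j y, `|y - x| <= r -> `|rpartial j u y| <= M) ->
  forall y, `|y - x| <= r -> `|u y - u x| <= d%:R * M * `|y - x|.
Proof.
move=> du uM y yr.
(* The first i coordinates of y followed by the last ones of x. *)
pose z i := \row_j (if (j < i)%N then y ord0 j else x ord0 j).
have z0 : z 0 = x by apply/rowP => j; rewrite mxE.
have zd : z d = y by apply/rowP => j; rewrite mxE ltn_ord.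
have step i (id : (i < d)%N) : z i.+1 = z i + (y ord0 (Ordinal id) - x ord0 (Ordinal id)) *:
    basis_vec (Ordinal id).
  apply/rowP => j; rewrite !mxE eqxx /=.
  have [->|ji] := eqVneq j (Ordinal id).
    by rewrite /= ltnS leqnn ltnn mulr1 addrCA subrr addr0.
  rewrite mulr0 addr0 ltnS leq_eqVlt; case: eqP => //= e.
  by move: ji; rewrite -val_eqE /= e eqxx.
have H i : (i <= d)%N -> `|u (z i) - u x| <= i%:R * M * `|y - x|.
  elim: i => [_|i IH id]; first by rewrite z0 subrr normr0 !mul0r.
  set j := Ordinal id.
  have [c cle e] := MVT_line u (basis_vec j) (du j) (z i) (y ord0 j - x ord0 j).
  rewrite -(subrK (u (z i)) (u (z i.+1))) -addrA.
  rewrite (le_trans (ler_normD _ _))// -natr1 mulrDl mulrDl [leLHS]addrC lerD//.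
    by apply: IH; exact: ltnW.
  rewrite step e normrM mul1r mulrC ler_pM//.
    apply: uM; apply: le_trans yr; apply: norm_le_coord => // k.
    rewrite !mxE eqxx /=.
    have ck k' : `|y ord0 k' - x ord0 k'| <= `|y - x|.
      by have := coord_le_norm (y - x) k'; rewrite !mxE.
    have [->|kj] := eqVneq k j.
      rewrite mulr1 /= ltnn addrAC subrr add0r (le_trans cle)//.
    rewrite mulr0 addr0; case: ifP => _ //; by rewrite subrr normr0.
  by have := coord_le_norm (y - x) j; rewrite !mxE.
by have := H d (leqnn d); rewrite zd.
Qed.

Lemma rC1_continuous u : rC1 u -> continuous u.
Proof.
move=> u1; suff H (x : 'rV[R]_d) : u y @[y --> x] --> u x by move=> x; exact: H.
have [r r0 ur] : exists2 r : R, 0 < r & forall j y, `|y - x| <= r -> `|rpartial j u y| <= 1 +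
    \sum_k `|rpartial k u x|.
  pose N := 1 + \sum_k `|rpartial k u x|.
  have ball_j j : \forall y \near x, `|rpartial j u y| <= N.
    have cj := (u1 j).2 x.
    have : `|rpartial j u x| < N.
      by rewrite /N (bigD1 j)//= addrCA ltrDl ltr_pwDl// sumr_ge0.
    by move=> jN; apply: (cvgr_norm_le _ cj N jN).
  have := @filter_forall _ _ (fun j => [set y | `|rpartial j u y| <= N]) (nbhs x) (nbhs_filter
      x) ball_j.
  move=> /(@nbhs_normP _ _ x) [e /= e0 H]; exists (e / 2); first by rewrite divr_gt0.
  move=> j y yx; apply: H => /=; rewrite distrC (le_lt_trans yx)//.
  by rewrite ltr_pdivrMr// ltr_pMr// ltr1n.
set M := 1 + _ in ur.
have M0 : 0 <= M by rewrite addr_ge0// sumr_ge0.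
apply/(@cvgrPdist_lt _ _ _ (nbhs x) (nbhs_filter x)) => e e0.
have K0 : 0 < d%:R * M + 1 by rewrite ltr_wpDl// mulr_ge0.
have lip := bounded_partials_lipschitz u x r M (fun j => (u1 j).1) ur.
apply/(@nbhs_normP _ _ x); exists (Num.min r (e / (d%:R * M + 1))).
  by rewrite /= lt_min r0 divr_gt0.
move=> y /=; rewrite (distrC x) => yx.
move: yx; rewrite lt_min => /andP[yr ye].
rewrite distrC (le_lt_trans (lip y (ltW yr)))//.
rewrite (@le_lt_trans _ _ ((d%:R * M + 1) * `|y - x|))//.
  by rewrite ler_wpM2r// lerDl.
by rewrite mulrC -ltr_pdivlMr.
Qed.

(** The sigma-algebra is generated by the coordinates; sup-norm balls are boxes,
    and those with rational data form a countable base of the topology. *)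
Lemma open_measurable_rV (A : set 'rV[R]_d) : open A -> measurable A.
Proof.
move=> oA.
pose q2r (q : 'rV[rat]_d) : 'rV[R]_d := map_mx ratr q.
pose B (p : 'rV[rat]_d * nat) := [set y : 'rV[R]_d | forall j, `|q2r p.1 ord0 j - y ord0 j| <
    p.2.+1%:R^-1].
have mB p : measurable (B p).
  rewrite (_ : B p = \bigcap_(j in [set: 'I_d]) (rV_coord j @^-1` [set r | `|q2r p.1 ord0 j -
      r| < p.2.+1%:R^-1])).
    apply: fin_bigcap_measurable => // j _.
    rewrite -[X in measurable X]setTI; apply: measurable_rV_coord => //.
    set q := q2r _ _ _; set e := _^-1.
    rewrite (_ : [set r | _] = `](q - e), (q + e)[%classic)//.
    by apply/seteqP; split => r /=; rewrite in_itv /= distrC ltr_distl.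
  by apply/seteqP; split => y /= H j; [move=> _; exact: H|exact: (H j I)].
rewrite (_ : A = \bigcup_p (if `[< B p `<=` A >] then B p else set0)).
  by apply: countable_bigcupT_measurable => // p; case: ifP.
apply/seteqP; split; last first.
  by move=> x [p _]; case: ifPn => // /asboolP; apply.
move=> x Ax.
have /(@nbhs_normP _ _ x)[e /= e0 eA] : nbhs x A by exact: open_nbhs_nbhs.
have [n ne] : exists n, (n.+1%:R^-1 : R) < e / 2.
  have e2 : 0 < e / 2 by rewrite divr_gt0.
  have [n _ /(_ n (leqnn n)) ] := near_infty_natSinv_lt (PosNum e2).
  by exists n.
have hq j : exists q : rat, `|ratr q - x ord0 j| < n.+1%:R^-1.
  have [q] := @rat_in_itvoo R (x ord0 j - n.+1%:R^-1) (x ord0 j + n.+1%:R^-1) ltac:(rewrite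
      ltrBlDr -addrA ltrDl addr_gt0// invr_gt0 ltr0n//).
  rewrite in_itv /= => /andP[q1 q2]; exists q.
  by rewrite ltr_distl q1.
have [q Hq] := choice hq.
exists (\row_j q j, n) => //.
have Bx : B (\row_j q j, n) x by move=> j /=; rewrite !mxE.
case: ifPn => // /asboolP []; move=> y By; apply: eA => /=.
have n0 : 0 < n.+1%:R^-1 :> R by rewrite invr_gt0 ltr0n.
rewrite (@le_lt_trans _ _ (n.+1%:R^-1 + n.+1%:R^-1))//; last by rewrite (splitr e) ltrD.
apply: norm_le_coord; first by rewrite addr_ge0// ltW.
move=> j; rewrite !mxE.
have := Bx j; have := By j; rewrite /= => h1 h2; apply: ltW.
rewrite -(subrK (q2r (\row_j q j) ord0 j) (x ord0 j)) -addrA.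
by rewrite (le_lt_trans (ler_normD _ _))// ltrD// distrC.
Qed.

Lemma continuous_measurable_rV u : continuous u -> measurable_fun [set: 'rV[R]_d] u.
Proof.
move=> /continuousP cu; apply: (measurability _ (measurable_realfun.RGenOInfty.measurableE R))
    => //.
move=> _ [_ [x ->] <-]; rewrite setTI; apply: open_measurable_rV.
by apply: cu; exact: interval_open.
Qed.

End coordinate_lines.

(** * Integration in several variables *)

Section fubini_rV.
Context {R : realType}.
Local Notation mu1 := (@lebesgue_measure R).

Lemma measurable_cons_rV_section n (t : R) :
  measurable_fun [set: 'rV[R]_n] (fun v => @cons_rV R n (t, v)).
Proof.
apply: (measurableT_comp (@measurable_cons_rV R n)).
exact: pair1_measurable.
Qed.

Lemma tonelli_rV n (h : 'rV[R]_n.+1 -> \bar R) :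
  measurable_fun [set: 'rV[R]_n.+1] h -> (forall x, (0 <= h x)%E) ->
  (\int[lebesgue_rV n.+1]_x h x =
   \int[mu1]_t \int[lebesgue_rV n]_v h (@cons_rV R n (t, v)))%E.
Proof.
move=> mh h0.
transitivity (\int[mu1 \x lebesgue_rV n]_p h (cons_rV p))%E.
  exact: (@ge0_integral_pushforward _ _ _ _ _ (@cons_rV R n) _ (mu1 \x lebesgue_rV n)%E setT h).
rewrite fubini_tonelli1//.
by apply: measurableT_comp => //; exact: measurable_cons_rV.
Qed.

Lemma measurable_section_integral n (h : 'rV[R]_n.+1 -> \bar R) :
  measurable_fun [set: 'rV[R]_n.+1] h -> (forall x, (0 <= h x)%E) ->
  measurable_fun [set: measurableTypeR R] (fun t => \int[lebesgue_rV n]_v h (@cons_rV R n (t,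
      v)))%E.
Proof.
move=> mh h0.
have mhc : measurable_fun [set: measurableTypeR R * 'rV[R]_n] (h \o @cons_rV R n).
  by apply: measurableT_comp => //; exact: measurable_cons_rV.
refine (@measurable_fun_fubini_tonelli_F _ _ _ _ _ (lebesgue_rV n) _ mhc (fun p => h0 _)).
Qed.

Lemma lebesgue_measure_scale (c : R) : 0 < c ->
  forall A : set (measurableTypeR R), measurable A ->
    mu1 A = (c%:E * mu1 ((fun x : R => (c * x)%R) @^-1` A))%E.
Proof.
move=> c0 A mA.
have mf : measurable_fun [set: measurableTypeR R] (fun x : measurableTypeR R => (c * x :
    measurableTypeR R)).
  exact: mulrl_measurable.
(* The pushforward is a measure only because of [mf], which unification
   cannot guess. *)
pose nu : {measure set (measurableTypeR R) -> \bar R} :=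
  @measure_function_pushforward__canonical__measure_function_Measure
    _ _ _ _ _ mu1 _ mf.
rewrite -[RHS]/(mscale (NngNum (ltW c0)) nu A).
apply: (@lebesgue_measure_unique R (mscale (NngNum (ltW c0)) nu)) => //.
move=> _ [[a b] _ <-]; rewrite -[RHS]/(c%:E * mu1 ((fun x : R => (c * x)%R) @^-1` `]a, b]))%E.
rewrite (_ : _ @^-1` _ = `](a / c), (b / c)]%classic); last first.
  apply/seteqP; split => x /=; rewrite !in_itv /=.
    by rewrite ltr_pdivrMr// ler_pdivlMr// (mulrC x).
  by rewrite ltr_pdivrMr// ler_pdivlMr// (mulrC x).
rewrite !lebesgue_measure_itv/= !lte_fin ltr_pM2r ?invr_gt0//.
case: ifP => _; last by rewrite mule0.
by rewrite -EFinM -mulrBl mulrC divfK// gt_eqF.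
Qed.

Lemma integral_scale1 (c : R) (h : R -> \bar R) : 0 < c ->
  measurable_fun [set: R] h -> (forall x, (0 <= h x)%E) ->
  (\int[mu1]_x h x = c%:E * \int[mu1]_x h (c * x)%R)%E.
Proof.
move=> c0 mh h0.
have mf : measurable_fun [set: measurableTypeR R] (fun x : measurableTypeR R => (c * x :
    measurableTypeR R)).
  exact: mulrl_measurable.
(* The pushforward is a measure only because of [mf], which unification
   cannot guess. *)
pose nu : {measure set (measurableTypeR R) -> \bar R} :=
  @measure_function_pushforward__canonical__measure_function_Measure
    _ _ _ _ _ mu1 _ mf.
transitivity (\int[mscale (NngNum (ltW c0)) nu]_x h x)%E.
  by apply: eq_measure_integral => A mA _; exact: lebesgue_measure_scale.
rewrite ge0_integral_mscale//.
by congr (_ * _)%E; exact: (ge0_integral_pushforward mf mu1).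
Qed.

Lemma measurable_scaler n (c : R) : measurable_fun [set: 'rV[R]_n] (fun x => c *: x).
Proof.
apply/measurable_fun_rVP => i.
rewrite (_ : _ \o _ = (fun r => c * r) \o rV_coord i).
  by apply: measurableT_comp; [exact: mulrl_measurable|exact: measurable_rV_coord].
by apply/funext => x; rewrite /rV_coord /= mxE.
Qed.

Lemma integral_scale_rV n (c : R) (h : 'rV[R]_n -> \bar R) : 0 < c ->
  measurable_fun [set: 'rV[R]_n] h -> (forall x, (0 <= h x)%E) ->
  (\int[lebesgue_rV n]_x h x = (c ^+ n)%:E * \int[lebesgue_rV n]_x h (c *: x)%R)%E.
Proof.
move=> c0; elim: n h => [|n IH] h mh h0.
  rewrite expr0 mul1e; apply: eq_integral => x _.
  by congr h; apply/rowP => -[].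
have mhc : measurable_fun [set: 'rV[R]_n.+1] (fun x => h (c *: x)).
  by apply: (measurableT_comp mh); exact: measurable_scaler.
rewrite !tonelli_rV//.
rewrite (@integral_scale1 c)//; last 2 first.
  exact: measurable_section_integral.
  by move=> x; exact: integral_ge0.
rewrite exprS EFinM -muleA; congr (_ * _)%E.
rewrite -ge0_integralZl//; last 3 first.
- exact: (measurable_section_integral n (fun x => h (c *: x))).
- by move=> x _; exact: integral_ge0.
- by rewrite lee_fin exprn_ge0// ltW.
apply: eq_integral => t _; rewrite IH//; last first.
  by apply: measurableT_comp => //; exact: measurable_cons_rV_section.
congr (_ * _)%E; apply: eq_integral => v _; congr h.
by apply/rowP => i; rewrite !mxE; case: (unlift _ _) => [j|]; rewrite ?mxE.
Qed.

Lemma integral_rV_prod n (w : R -> R) : measurable_fun [set: R] w ->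
  (forall t, 0 <= w t) ->
  (\int[lebesgue_rV n]_x (\prod_(j < n) w (x ord0 j))%:E =
   \prod_(j < n) \int[mu1]_t (w t)%:E)%E.
Proof.
move=> mw w0; elim: n => [|n IH].
  rewrite big_ord0; under eq_integral do rewrite big_ord0.
  by rewrite integral_cst//= diracT mule1.
have mp k : measurable_fun [set: 'rV[R]_k] (fun x => (\prod_(j < k) w (x ord0 j))%:E).
  apply/measurable_EFinP; apply: measurable_prod => j _.
  by apply: (measurableT_comp mw); exact: measurable_rV_coord.
have p0 k (x : 'rV[R]_k) : (0 <= (\prod_(j < k) w (x ord0 j))%:E)%E.
  by rewrite lee_fin prodr_ge0.
rewrite tonelli_rV// big_ord_recl -IH -ge0_integralZr//; last 3 first.
- exact/measurable_EFinP.
- by move=> x _; rewrite lee_fin.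
- by apply: integral_ge0 => x _.
congr (integral _ _ _); apply/funext => t;
rewrite -ge0_integralZl//; try exact: mp; try by rewrite lee_fin.
apply: eq_integral => v _; rewrite -EFinM big_ord_recl; congr (_ * _)%:E.
  by rewrite mxE unlift_none.
by apply: eq_bigr => j _; rewrite mxE liftK.
Qed.
End fubini_rV.

(** * Weights of polynomial decay *)

Section weights.
Context {R : realType}.
Local Notation mu1 := (@lebesgue_measure R).

(** Comparable to |x|^-s at infinity and bounded near 0, so that one envelope
    controls a function of power decay everywhere.  A negative s describes
    polynomial growth. *)
Definition wt {V : normedModType R} (s : R) (x : V) : R := (1 + `|x|) `^ (- s).

Section normed.
Context {V : normedModType R}.
Implicit Types (x y z : V) (s t c : R).

Lemma wt_base_gt0 x : 0 < 1 + `|x|.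
Proof. by rewrite ltr_pwDl. Qed.

Lemma wt_gt0 s x : 0 < wt s x.
Proof. by rewrite powR_gt0// wt_base_gt0. Qed.

Lemma wt_ge0 s x : 0 <= wt s x.
Proof. exact/ltW/wt_gt0. Qed.

Lemma wtD s t x : wt (s + t) x = wt s x * wt t x.
Proof.
rewrite /wt opprD powRD//.
by apply/implyP => _; rewrite gt_eqF// wt_base_gt0.
Qed.

Lemma wt_anti s t x : s <= t -> wt t x <= wt s x.
Proof. by move=> st; rewrite ler_powR ?lerN2// lerDl. Qed.

(** Every comparison of weights comes down to a linear one of their bases. *)
Lemma wt_comp {W : normedModType R} s c (y : W) z : 0 <= s -> 0 < c ->
  1 + `|y| <= c * (1 + `|z|) -> wt s z <= c `^ s * wt s y.
Proof.
move=> s0 c0 yz; rewrite /wt !powRN ler_pdivlMr ?powR_gt0 ?ltr_pwDl//.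
rewrite mulrC ler_pdivrMr ?powR_gt0 ?wt_base_gt0//.
rewrite -powRM ?(ltW c0) ?(ltW (wt_base_gt0 _))//.
by apply: ge0_ler_powR; rewrite ?nnegrE ?mulr_ge0 ?addr_ge0 ?(ltW c0).
Qed.

Lemma wt_continuous s : continuous (@wt V s).
Proof.
move=> x; rewrite /wt.
have cn : {for x, continuous (fun y : V => 1 + `|y|)}.
  by apply: cvgD; [exact: cvg_cst|exact: norm_continuous].
apply: (@continuous_comp _ _ _ (fun y : V => 1 + `|y|) (fun r => r `^ (- s))) => //.
apply: differentiable_continuous; apply/derivable1_diffP.
by apply: derivable_powR; rewrite in_itv /= andbT wt_base_gt0.
Qed.

End normed.

Lemma wt1_integral (p : R) : 1 < p -> (\int[mu1]_t (wt p (t : R^o))%:E < +oo)%E.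
Proof.
move=> p1.
have cw : continuous (wt p : R -> R) by exact: (@wt_continuous R^o).
rewrite (@ge0_symfun_integralT _ (wt p))//; last 2 first.
- by move=> x; exact: wt_ge0.
- by move=> x; rewrite /wt /= normrN.
rewrite (_ : [set x | _] = `[0, +oo[%classic); last first.
  by apply/seteqP; split => x/=; rewrite in_itv/= andbT.
(* A primitive of the weight on the half-line, which vanishes at infinity. *)
pose F (x : R) := (1 - p)^-1 * (1 + x) `^ (1 - p).
have p1n : 1 - p != 0 by rewrite subr_eq0 lt_eqF.
have dF (x : R) : 0 <= x -> is_derive x (1 : R) F (wt p x).
  move=> x0; have x1 : 0 < 1 + x by rewrite ltr_wpDr.
  have h1 : is_derive x (1:R) (fun y : R => 1 + y) 1.
    have := is_deriveD (is_derive_cst (1:R) x (1:R)) (is_derive_id x (1 : R)).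
    by rewrite add0r.
  have h2 := @is_derive1_comp R (fun r : R => r `^ (1 - p)) (fun y => 1 + y) x _ _
      (@is_derive1_powR R (1 - p) _ x1) h1.
  have := @is_deriveZ _ _ _ ((fun r : R => r `^ (1 - p)) \o (fun y : R => 1 + y)) (1 - p)^-1 _
      _ _ h2.
  have -> : (1 - p)^-1 *: ((1 - p) * (1 + x) `^ (1 - p - 1) * 1) = wt p x.
    rewrite mulr1 /GRing.scale /= mulrA mulVf// mul1r /wt ger0_norm//.
    by congr (_ `^ _); ring.
  by [].
rewrite (@ge0_continuous_FTC2y R (wt p) F 0 0)//.
- by rewrite -EFinD ltry.
- by move=> x _; exact: wt_ge0.
- exact: continuous_subspaceT.
- rewrite /F -[X in _ --> X](mulr0 (1-p)^-1); apply: cvgM; first exact: cvg_cst.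
  apply/cvgrPdist_lt => e e0; near=> x.
  rewrite sub0r normrN ger0_norm ?powR_ge0//.
  have q0 : 0 < p - 1 by rewrite subr_gt0.
  rewrite -opprB powRN invf_plt ?posrE ?powR_gt0//; last first.
    by rewrite (@lt_le_trans _ _ 1)// lerDl; near: x; apply: nbhs_pinfty_ge; rewrite num_real.
  have ei : 0 < e^-1 by rewrite invr_gt0.
  rewrite (_ : e^-1 = (e^-1 `^ (p - 1)^-1) `^ (p - 1)); last first.
    by rewrite -powRrM mulVf ?gt_eqF// powRr1// ltW.
  have xe : e^-1 `^ (p - 1)^-1 <= x by near: x; apply: nbhs_pinfty_ge; rewrite num_real.
  have A0 := powR_ge0 e^-1 (p - 1)^-1.
  apply: gt0_ltr_powR => //; rewrite ?nnegrE//; last by rewrite (le_lt_trans xe)// ltrDr.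
  by rewrite addr_ge0// (le_trans A0).
- by move=> x x0; have [] := dF x (ltW x0).
- apply: cvg_at_right_filter; apply: differentiable_continuous; apply/derivable1_diffP.
  by have [] := dF 0 (lexx _).
- move=> x; rewrite in_itv /= andbT => x0; rewrite derive1E.
  by have [_ ->] := dF x (ltW x0).
Unshelve. all: by end_near. Qed.

Section rV.
Context {d : nat} (d0 : (0 < d)%N).

(** The exponent is shared equally among the d coordinates: the product on the
    right is integrable as soon as s / d > 1. *)
Lemma wt_le_prod s (x : 'rV[R]_d) : 0 <= s -> wt s x <= \prod_(j < d) wt (s / d%:R) (x ord0 j :
    R^o).
Proof.
move=> s0; have dn : d%:R != 0 :> R by rewrite pnatr_eq0 -lt0n.
have -> : wt s x = \prod_(j < d) wt (s / d%:R) x.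
  rewrite prodr_const card_ord -powR_mulrn ?wt_ge0// /wt -powRrM.
  by congr (_ `^ _); field.
apply: ler_prod => j _; rewrite wt_ge0 /=.
apply: le_trans (wt_comp _ 1 (x ord0 j : R^o) _ _ _ _) _ => //.
- by rewrite divr_ge0.
- by rewrite mul1r lerD2l; exact: coord_le_norm.
- by rewrite powR1 mul1r.
Qed.

Lemma wt_measurable s : measurable_fun [set: 'rV[R]_d] (wt s).
Proof. apply: continuous_measurable_rV; exact: wt_continuous. Qed.

Lemma wt_integrable s : d%:R < s -> (lebesgue_rV d).-integrable setT (EFin \o (wt s : 'rV[R]_d
    -> R)).
Proof.
move=> ds; have d0' : 0 < d%:R :> R by rewrite ltr0n.
apply/integrableP; split; first by apply/measurable_EFinP; exact: wt_measurable.
apply: (@le_lt_trans _ _ (\int[lebesgue_rV d]_x (\prod_(j < d) wt (s / d%:R) (x ord0 j :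
    R^o))%:E)%E).
  apply: ge0_le_integral => //.
  - by apply/measurable_EFinP; apply: measurableT_comp => //; exact: wt_measurable.
  - apply/measurable_EFinP; apply: measurable_prod => j _.
    apply: measurableT_comp; last exact: measurable_rV_coord.
    by apply: continuous_measurable_fun; exact: (@wt_continuous R^o).
  - move=> x _ /=; rewrite lee_fin ger0_norm ?wt_ge0//; apply: wt_le_prod.
    by rewrite (le_trans (ltW d0'))// ltW.
rewrite (@integral_rV_prod R d (fun t => wt (s / d%:R) (t : R^o))); last 2 first.
- by apply: continuous_measurable_fun; exact: (@wt_continuous R^o).
- by move=> t; exact: wt_ge0.
set I := (\int[_]_t _)%E.
have Ifin : (I \is a fin_num)%E.
  rewrite ge0_fin_numE; last by apply: integral_ge0 => t _; rewrite lee_fin wt_ge0.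
  by apply: wt1_integral; rewrite ltr_pdivlMr// mul1r.
have : (\prod_(j < d) I)%E \is a fin_num.
  by elim/big_ind : _ => // x y xf yf; exact: fin_numM.
by rewrite fin_numE lt_neqAle leey andbT => /andP[].
Qed.

Lemma norm_rV_int_sub_le (k : 'rV[int]_d) (x : 'rV[R]_d) :
  cell (x - rV_of_int k) -> `|x - rV_of_int k| <= 2^-1.
Proof.
move=> xk; apply: norm_le_coord => // j.
by have /andP[h1 h2] := xk j; rewrite ler_norml h1 ltW.
Qed.

Lemma cell_translate_measurable (k : 'rV[int]_d) :
  measurable [set x : 'rV[R]_d | cell (x - rV_of_int k)].
Proof.
rewrite (_ : mkset _ = \bigcap_(j in [set: 'I_d])
    (rV_coord j @^-1` `[((k ord0 j)%:~R - 2^-1 : R), ((k ord0 j)%:~R + 2^-1 : R)[%classic)).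
  apply: fin_bigcap_measurable => // j _; rewrite -[X in measurable X]setTI.
  exact: measurable_rV_coord.
apply/seteqP; split => x /= xk j; rewrite /rV_coord.
  by move=> _ /=; have := xk j; rewrite in_itv /= !mxE lerBrDl ltrBlDl.
by have := xk j I; rewrite /= in_itv /= !mxE lerBrDl ltrBlDl.
Qed.

Lemma cell_translate_measure (k : 'rV[int]_d) :
  lebesgue_rV d [set x : 'rV[R]_d | cell (x - rV_of_int k)] = 1%E.
Proof.
pose a : 'rV[R]_d := \row_j ((k ord0 j)%:~R - 2^-1).
pose b : 'rV[R]_d := \row_j ((k ord0 j)%:~R + 2^-1).
have -> : [set x : 'rV[R]_d | cell (x - rV_of_int k)] =
    [set x | forall i, a ord0 i <= x ord0 i < b ord0 i].
  by apply/seteqP; split => x /= xk j; have := xk j; rewrite !mxE lerBrDl ltrBlDl.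
rewrite lebesgue_rV_box; last by move=> i; rewrite !mxE lerD2l; lra.
by rewrite big1// => i _; rewrite !mxE; lra.
Qed.

Lemma cell_translate_disjoint : trivIset [set: 'rV[int]_d]
  (fun k => [set x : 'rV[R]_d | cell (x - rV_of_int k)]).
Proof.
move=> k l _ _ [x [/= xk xl]]; apply/rowP => j.
have /andP[k1 k2] := xk j; have /andP[l1 l2] := xl j.
move: k1 k2 l1 l2; rewrite !mxE => k1 k2 l1 l2.
have h1 : (k ord0 j)%:~R < (l ord0 j)%:~R + 1 :> R by lra.
have h2 : (l ord0 j)%:~R < (k ord0 j)%:~R + 1 :> R by lra.
move: h1 h2; rewrite -[1]/(1%:~R) -!intrD !ltr_int !ltzD1 => h1 h2.
by apply/eqP; rewrite eq_le h1.
Qed.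

(** Comparison with the integral: the weight at k is at most a constant times
    its integral over the unit cell around k, and these cells are disjoint. *)
Lemma wt_summable s : d%:R < s ->
  abs_summable (fun k : 'rV[int]_d => wt s (rV_of_int k : 'rV[R]_d)).
Proof.
move=> ds.
have s0 : 0 <= s by rewrite (le_trans _ (ltW ds)).
have /integrableP[mw iw] := wt_integrable s ds.
have iw' : ((2 `^ s)%:E * \int[lebesgue_rV d]_x (wt s (x : 'rV[R]_d))%:E < +oo)%E.
  rewrite lte_mul_pinfty ?lee_fin ?powR_ge0//; apply: le_lt_trans iw.
  apply: ge0_le_integral => //.
  - by move=> x _; rewrite lee_fin wt_ge0.
  - exact: measurableT_comp.
  - by move=> x _ /=; rewrite lee_fin ler_norm.
apply: le_lt_trans iw'; apply: ge_ereal_sup => _ [X [fX _] <-].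
pose Q (k : 'rV[int]_d) := [set x : 'rV[R]_d | cell (x - rV_of_int k)].
have mQ k : measurable (Q k) by exact: cell_translate_measurable.
have w0 (x : 'rV[R]_d) : (0 <= (wt s x)%:E)%E by rewrite lee_fin wt_ge0.
have H (k : 'rV[int]_d) : (`|(wt s (rV_of_int k : 'rV[R]_d))%:E| <=
    (2 `^ s)%:E * \int[lebesgue_rV d]_(x in Q k) (wt s x)%:E)%E.
  rewrite gee0_abs// -ge0_integralZl//;
    try (exact: (measurable_funTS mw)); try exact: mQ;
    try by rewrite lee_fin powR_ge0.
  rewrite -[leLHS]mule1 -(cell_translate_measure k) -integral_cst; last exact: mQ.
  apply: ge0_le_integral => //.
  - exact: mQ.
  - by move=> x _; exact: w0.
  - by apply: emeasurable_funM => //; exact: (measurable_funTS mw).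
  - move=> x xk /=; rewrite -EFinM lee_fin; apply: wt_comp => //.
    have := norm_rV_int_sub_le _ _ xk.
    have := ler_normD (x - rV_of_int k) (rV_of_int k); rewrite subrK.
    have := normr_ge0 (rV_of_int k : 'rV[R]_d).
    lra.
apply: le_trans (lee_fsum fX (fun k _ => H k)) _.
rewrite -ge0_mule_fsumr; last by move=> k; exact: integral_ge0.
apply: lee_wpmul2l; first by rewrite lee_fin powR_ge0.
rewrite fsbig_finite//= -ge0_integral_bigsetU//; last 3 first.
- exact: finmap.fset_uniq.
- by apply: sub_trivIset cell_translate_disjoint => ?.
- exact: (measurable_funTS mw).
apply: ge0_subset_integral => //.
by apply: bigsetU_measurable => k _.
Qed.

End rV.
End weights.

(** * Periodization of functions of class C^1 *)

Section directional.
Context {R : realType} {d : nat}.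
Implicit Types (u : 'rV[R]_d -> R) (x v : 'rV[R]_d).

Lemma is_derive_of_line u x v (l : R) :
  is_derive (0 : R) (1 : R) (fun t : R => u (x + t *: v)) l -> is_derive x v u l.
Proof.
have e : (fun h : R => h^-1 *: (((fun t => u (x + t *: v)) \o shift 0) (h *: (1 : R)) - u (x +
    0 *: v)))
    = (fun h : R => h^-1 *: ((u \o shift x) (h *: v) - u x)).
  apply/funext => h /=; congr (_ *: (u _ - u _)); last by rewrite scale0r addr0.
  by rewrite [h *: 1]mulr1 addr0 addrC.
by case=> du Du; apply: DeriveDef; [move: du|move: Du]; rewrite /derivable /derive e.
Qed.

Lemma is_derive_scale u x v (c : R) : derivable u (c *: x) v ->
  is_derive x v (fun y => u (c *: y)) (c * 'D_v u (c *: x)).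
Proof.
move=> du; apply: is_derive_of_line.
have h1 : is_derive (0 : R) (1 : R) (fun t : R => c * t) c.
  have := @is_deriveZ _ _ _ id c (0 : R) (1 : R) _ (is_derive_id (0 : R) (1 : R)).
  by rewrite /GRing.scale /= mulr1.
have h2 : is_derive (c * 0) (1 : R) (fun t : R => u (c *: x + t *: v)) ('D_v u (c *: x)).
  have := @is_derive_line R d u (c *: x) v 0.
  by rewrite mulr0 scale0r addr0; apply.
have := @is_derive1_comp _ _ _ _ _ _ h2 h1.
rewrite mulrC; congr (is_derive _ _ _ _).
by apply/funext => t /=; rewrite scalerDr scalerA.
Qed.

Lemma norm_basis_vec_le1 j : `|basis_vec j : 'rV[R]_d| <= 1.
Proof.
apply: norm_le_coord => // k; rewrite !mxE eqxx /=.
by case: (k == j); rewrite ?normr1 ?normr0.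
Qed.

End directional.

Section periodization.
Context {R : realType} {d : nat} (d0 : (0 < d)%N).
Implicit Types (u : 'rV[R]_d -> R) (x y : 'rV[R]_d).

Definition decays (s : R) u := exists K, forall x, `|u x| <= K * wt s x.

Definition periodization u x := Zsum (fun k => u (x + rV_of_int k)).

Lemma wt_translate s x y : 0 <= s -> wt s (x + y) <= (1 + `|x|) `^ s * wt s y.
Proof.
move=> s0; apply: wt_comp; rewrite ?wt_base_gt0//.
have := ler_normB (x + y) x; rewrite (addrC x) addrK => h.
have := normr_ge0 x; have := normr_ge0 (y + x); nra.
Qed.

Lemma decays_scale s c u : 0 <= s -> 0 < c -> decays s u -> decays s (fun x => u (c *: x)).
Proof.
move=> s0 c0 [K uK]; exists (K * (1 + c^-1) `^ s) => x.
have K0 : 0 <= K by have := le_trans (normr_ge0 _) (uK x); rewrite pmulr_lge0// wt_gt0.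
apply: (le_trans (uK _)); rewrite -mulrA ler_wpM2l//; apply: wt_comp => //.
  by rewrite addr_gt0// invr_gt0.
rewrite normrZ gtr0_norm// mulrDl mul1r mulrDr mulKf ?gt_eqF//.
have : 0 < c^-1 by rewrite invr_gt0.
have : 0 <= c * `|x| by rewrite mulr_ge0// ltW.
have := normr_ge0 x; lra.
Qed.

(** One summable majorant serves all the points near x, which is what Tannery's
    theorem needs for limits at x. *)
Lemma decays_translate_bound s u : 0 <= s -> decays s u -> forall x, exists2 C, 0 <= C &
  forall y, `|y - x| <= 1 -> forall k : 'rV[int]_d, `|u (y + rV_of_int k)| <= C * wt s
      (rV_of_int k : 'rV[R]_d).
Proof.
move=> s0 [K uK] x.
have K0 : 0 <= K by have := le_trans (normr_ge0 _) (uK 0); rewrite pmulr_lge0// wt_gt0.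
exists (K * (2 + `|x|) `^ s); first by rewrite mulr_ge0// powR_ge0.
move=> y yx k; apply: (le_trans (uK _)); rewrite -mulrA ler_wpM2l//.
apply: (le_trans (wt_translate _ _ _ s0)); rewrite ler_wpM2r ?wt_ge0//.
have yn : `|y| <= 1 + `|x|.
  by rewrite -(subrK x y) (le_trans (ler_normD _ _))// lerD2r.
apply: ge0_ler_powR; rewrite ?nnegrE ?addr_ge0//; lra.
Qed.

Lemma periodization_summable s u x : d%:R < s -> decays s u ->
  abs_summable (fun k : 'rV[int]_d => u (x + rV_of_int k)).
Proof.
move=> ds us; have s0 : 0 <= s by rewrite (le_trans _ (ltW ds)).
have [C C0 H] := decays_translate_bound s u s0 us x.
apply: abs_summable_le (abs_summableZ C _ (wt_summable d0 s ds)) _.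
by move=> k; apply: H; rewrite subrr normr0.
Qed.

Lemma periodization_continuous s u : d%:R < s -> decays s u -> continuous u ->
  continuous (periodization u).
Proof.
move=> ds us cu; suff H x : periodization u y @[y --> x] --> periodization u x by move=> x;
    exact: H.
have s0 : 0 <= s by rewrite (le_trans _ (ltW ds)).
have [C C0 H] := decays_translate_bound s u s0 us x.
apply: (Zsum_cvg (nbhs x) _ _ _ (abs_summableZ C _ (wt_summable d0 s ds))).
  apply/(@nbhs_normP _ _ x); exists 1 => //= y yx k.
  by apply: H; rewrite distrC ltW.
move=> k; apply: (@continuous_comp _ _ _ (fun y => y + rV_of_int k) u); last exact: cu.
by apply: continuousD; [move=> A|exact: cst_continuous].
Qed.

(** By the mean value theorem a difference quotient is a value of the derivative
    at a nearby point, hence dominated; Tannery's theorem then differentiates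
    term by term. *)
Lemma periodization_is_derive s u v x : d%:R < s -> `|v| <= 1 ->
  (forall y, derivable u y v) -> decays s u -> decays s (fun y => 'D_v u y) ->
  is_derive x v (periodization u) (periodization (fun y => 'D_v u y) x).
Proof.
move=> ds v1 du us dus; have s0 : 0 <= s by rewrite (le_trans _ (ltW ds)).
have [C C0 H] := decays_translate_bound s _ s0 dus x.
have lim : h^-1 *: ((periodization u \o shift x) (h *: v) - periodization u x) @[h --> (0 :
    R)^'] -->
    periodization (fun y => 'D_v u y) x.
  have -> : (fun h : R => h^-1 *: ((periodization u \o shift x) (h *: v) - periodization u x)) =
    (fun h : R => Zsum (fun k => h^-1 * (u (h *: v + x + rV_of_int k) - u (x + rV_of_int k)))).
    apply/funext => h /=; rewrite /periodization /GRing.scale /=.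
    have s1 := periodization_summable s u (h *: v + x) ds us.
    have s2 := periodization_summable s u x ds us.
    rewrite ZsumZ ?ZsumD ?ZsumN//; first exact: abs_summableN.
    by apply: abs_summableD => //; exact: abs_summableN.
  apply: (Zsum_cvg _ _ _ _ (abs_summableZ C _ (wt_summable d0 s ds))).
    near=> h => k.
    have h0 : h != 0 by near: h; exact: nbhs_dnbhs_neq.
    have [c ch e] := MVT_line u v du (x + rV_of_int k) h.
    rewrite -addrA (addrC (h *: v)) e mulKf//.
    rewrite addrAC; apply: H; rewrite addrAC subrr add0r normrZ.
    rewrite (le_trans _ v1)// ler_piMl// (le_trans ch)//.
    by near: h; exact: dnbhs0_le.
  move=> k; have := du (x + rV_of_int k); rewrite /derivable.
  have -> : 'D_v u (x + rV_of_int k) = lim (h^-1 *: ((u \o shift (x + rV_of_int k)) (h *: v) -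
      u (x + rV_of_int k)) @[h --> (0 : R)^']) by [].
  move=> cv; apply: cvg_trans cv; apply: near_eq_cvg; near=> h.
  by rewrite /= /GRing.scale /= addrA.
apply: DeriveDef; first by apply/cvg_ex; eexists; exact: lim.
exact: cvg_lim lim.
Unshelve. all: by end_near. Qed.

Lemma periodization_periodic u : Defs.periodic (periodization u).
Proof.
move=> x k; rewrite /periodization -[RHS](Zsum_shift _ k).
congr Zsum; apply/funext => l; congr u; rewrite -addrA; congr (_ + _).
by apply/rowP => j; rewrite !mxE -intrD addrC.
Qed.

Lemma periodization_rC1 s u : d%:R < s -> rC1 u -> decays s u ->
  (forall j, decays s (rpartial j u)) ->
  rC1 (periodization u) /\
  (forall j, rpartial j (periodization u) = periodization (rpartial j u)).
Proof.
move=> ds u1 us dus.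
have D j x := periodization_is_derive s u (basis_vec j) x ds (norm_basis_vec_le1 j)
  (u1 j).1 us (dus j).
have E j : rpartial j (periodization u) = periodization (rpartial j u).
  by apply/funext => x; rewrite /rpartial; have [_ ->] := D j x.
split=> // j; split; first by move=> x; have [] := D j x.
by rewrite E; apply: (periodization_continuous s) => //; exact: (u1 j).2.
Qed.

Lemma rC1_scale u (c : R) : rC1 u ->
  rC1 (fun x => u (c *: x)) /\
  (forall j, rpartial j (fun x => u (c *: x)) = (fun x => c * rpartial j u (c *: x))).
Proof.
move=> u1.
have D j x := @is_derive_scale R d u x (basis_vec j) c ((u1 j).1 _).
have E j : rpartial j (fun x => u (c *: x)) = (fun x => c * rpartial j u (c *: x)).
  by apply/funext => x; rewrite /rpartial; have [_ ->] := D j x.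
split=> // j; split; first by move=> x; have [] := D j x.
rewrite E => x.
apply: (@continuous_comp _ _ _ (fun y => rpartial j u (c *: y)) ( *%R c)); last exact:
    mulrl_continuous.
apply: (@continuous_comp _ _ _ (fun y => c *: y) (rpartial j u)); last exact: (u1 j).2.
exact: scaler_continuous.
Qed.

Lemma rC1_cmul u (c : R) : rC1 u ->
  rC1 (fun x => c * u x) /\
  (forall j, rpartial j (fun x => c * u x) = (fun x => c * rpartial j u x)).
Proof.
move=> u1.
have D j x : is_derive x (basis_vec j) (fun x => c * u x) (c * rpartial j u x).
  apply: (@is_deriveZ _ _ _ u c x (basis_vec j)).
  exact: DeriveDef ((u1 j).1 _) erefl.
have E j : rpartial j (fun x => c * u x) = (fun x => c * rpartial j u x).
  by apply/funext => x; rewrite /rpartial; have [_ ->] := D j x.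
split=> // j; split; first by move=> x; have [] := D j x.
rewrite E => x.
apply: (@continuous_comp _ _ _ (rpartial j u) ( *%R c)); last exact: mulrl_continuous.
exact: (u1 j).2.
Qed.

End periodization.

(** * Integration by parts on the torus *)

Section cell_integrals.
Context {R : realType}.
Local Notation mu1 := (@lebesgue_measure R).

Lemma tonelli_rV_swap n (h : 'rV[R]_n.+1 -> \bar R) :
  measurable_fun [set: 'rV[R]_n.+1] h -> (forall x, (0 <= h x)%E) ->
  (\int[lebesgue_rV n.+1]_x h x =
   \int[lebesgue_rV n]_v \int[mu1]_t h (@cons_rV R n (t, v)))%E.
Proof.
move=> mh h0; rewrite tonelli_rV//.
have mhc : measurable_fun [set: measurableTypeR R * 'rV[R]_n] (h \o @cons_rV R n).
  by apply: measurableT_comp => //; exact: measurable_cons_rV.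
exact: (@fubini_tonelli _ _ _ _ _ mu1 (lebesgue_rV n) _ mhc (fun p => h0 _)).
Qed.

Lemma measurable_cell n : measurable (cell : set 'rV[R]_n).
Proof.
have := @cell_translate_measurable R n 0; congr measurable.
by apply/funext => x /=; rewrite /rV_of_int map_mx0 subr0.
Qed.

Lemma cell_measure n : lebesgue_rV n (cell : set 'rV[R]_n) = 1%E.
Proof.
have := @cell_translate_measure R n 0; congr (lebesgue_rV n _ = _).
by apply/funext => x /=; rewrite /rV_of_int map_mx0 subr0.
Qed.

Lemma cell_cons n (t : R) (v : 'rV[R]_n) :
  cell (@cons_rV R n (t, v)) <-> (- 2^-1 <= t < 2^-1) /\ cell v.
Proof.
split=> [H|[ht hv] i].
  split; first by have := H ord0; rewrite mxE unlift_none.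
  by move=> j; have := H (lift ord0 j); rewrite mxE liftK.
by rewrite mxE; case: (unliftP ord0 i) => [j _|_] //=.
Qed.

Lemma cons_rV_line0 n (t : R) (v : 'rV[R]_n) :
  @cons_rV R n (t, v) = cons_rV (0 : measurableTypeR R, v) + t *: basis_vec ord0.
Proof.
apply/rowP => i; rewrite !mxE eqxx /=.
case: (unliftP ord0 i) => [j ->|->]; last by rewrite eqxx mulr1 add0r.
by rewrite eq_sym (negbTE (neq_lift _ _)) mulr0 addr0.
Qed.

Lemma cons_rV_line n (t s : R) (v : 'rV[R]_n) (j : 'I_n) :
  @cons_rV R n (t, v + s *: basis_vec j) = cons_rV (t, v) + s *: basis_vec (lift ord0 j).
Proof.
apply/rowP => i; rewrite !mxE eqxx /=.
case: (unliftP ord0 i) => [k ->|->]; first by rewrite !mxE eqxx /= (inj_eq lift_inj).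
by rewrite (negbTE (neq_lift _ _)) mulr0 addr0.
Qed.

Lemma cons_rV_continuous n (t : R) : continuous (fun v : 'rV[R]_n => cons_rV (t, v) : 'rV[R]_n.+1).
Proof.
move=> v; apply/(@cvgrPdist_lt _ _ _ (nbhs v) (nbhs_filter v)) => e e0.
apply/(@nbhs_normP _ _ v); exists e => //= w vw.
apply: le_lt_trans vw; apply: norm_le_coord => // i; rewrite !mxE.
case: (unliftP ord0 i) => [k _|_]; last by rewrite subrr normr0.
by have := coord_le_norm (v - w) k; rewrite !mxE.
Qed.

(** Along direction j the fundamental theorem of calculus gives K (x + e_j) - K x,
    and Tonelli's theorem integrates that constant in the other directions.
    Asking for a nonnegative derivative and a constant increment M, instead of a
    periodic K, avoids integrability conditions and survives the induction on
    the dimension. *)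
Lemma integral_cell_derivative n (j : 'I_n) (K k : 'rV[R]_n -> R) (M : R) :
  continuous k -> (forall x, cell x -> 0 <= k x) ->
  (forall x, is_derive x (basis_vec j) K (k x)) ->
  (forall x, K (x + basis_vec j) - K x = M) ->
  (\int[lebesgue_rV n]_(x in cell) (k x)%:E = M%:E)%E.
Proof.
elim: n j K k => [[]//|n IH] j K k ck k0 dK KM.
pose h (x : 'rV[R]_n.+1) := (if x \in cell then (k x)%:E else 0)%E.
have mk : measurable_fun [set: 'rV[R]_n.+1] (EFin \o k).
  by apply/measurable_EFinP; exact: continuous_measurable_rV.
have hE : h = (EFin \o k) \_ cell by apply/funext => x; rewrite patchE.
have mh : measurable_fun [set: 'rV[R]_n.+1] h.
  rewrite hE; apply/(measurable_restrictT _ (measurable_cell n.+1)).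
  exact: measurable_funTS.
have h0 x : (0 <= h x)%E by rewrite /h; case: ifPn => // /set_mem /k0; rewrite lee_fin.
rewrite integral_mkcond -[LHS]/(\int[lebesgue_rV n.+1]_x ((EFin \o k) \_ cell) x)%E -hE.
pose I := `[(- 2^-1 : R), 2^-1[%classic.
have muI : mu1 I = 1%E.
  rewrite /I lebesgue_measure_itv /= lte_fin ifT; last by lra.
  by rewrite -EFinD; congr EFin; lra.
have [ej|[j' ej]] : j = ord0 \/ exists j', j = lift ord0 j'.
  by case: (unliftP ord0 j) => [j' ej|ej]; [right; exists j'|left].
- rewrite {}ej in dK KM; rewrite tonelli_rV_swap//.
  transitivity (\int[lebesgue_rV n]_(v in cell) (cst M%:E) v)%E; last first.
    by rewrite integral_cst; [rewrite -[RHS]mule1; congr (_ * _)%E; exact: (cell_measure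
        n)|exact: (measurable_cell n)].
  rewrite [RHS]integral_mkcond; apply: eq_integral => v _; rewrite patchE.
  case: ifPn => [/set_mem cv|/negP ncv]; last first.
    apply: integral0_eq => t _; rewrite /h ifF//; apply/negP => /set_mem /cell_cons[_ cv].
    by apply: ncv; exact: mem_set.
  transitivity (\int[mu1]_(t in I) (k (cons_rV (t, v)))%:E)%E.
    rewrite [RHS]integral_mkcond; apply: eq_integral => t _; rewrite patchE /h.
    have -> : (cons_rV (t, v) \in cell) = (t \in I); last by [].
    apply/idP/idP => /set_mem.
      by move=> /cell_cons[tI _]; apply/mem_set; rewrite /I /= in_itv.
    by rewrite /I /= in_itv /= => tI; apply/mem_set/cell_cons.
  pose e0 : 'rV[R]_n.+1 := basis_vec ord0.
  pose x0 := @cons_rV R n (0, v).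
  have cline : continuous (fun t : R => k (x0 + t *: e0)).
    move=> t; apply: (@continuous_comp _ _ _ (fun t : R => x0 + t *: e0) k); last exact: ck.
    by apply: continuousD; [exact: cst_continuous|exact: scalel_continuous].
  have dline t : is_derive (t : R) (1 : R) (fun t : R => K (x0 + t *: e0)) (k (x0 + t *: e0)).
    have [dk <-] := dK (x0 + t *: e0).
    exact: is_derive_line.
  have cKline : continuous (fun t : R => K (x0 + t *: e0)).
    move=> t; apply: differentiable_continuous; apply/derivable1_diffP.
    by have [] := dline t.
  under eq_integral do rewrite cons_rV_line0 -/x0 -/e0.
  rewrite integral_itv_bndo_bndc; last first.
    by apply/measurable_EFinP; apply: measurable_funTS; exact: continuous_measurable_fun.
  rewrite (@continuous_FTC2 _ _ (fun t : R => K (x0 + t *: e0))).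
  + rewrite -EFinB; congr EFin; rewrite -(KM (x0 + (- 2^-1) *: e0)) -addrA -/e0.
    by rewrite -[X in _ + (_ + X)]scale1r -scalerDl; congr (K (_ + _ *: _) - _); lra.
  + lra.
  + exact: continuous_subspaceT.
  + split; first by move=> t _; have [] := dline t.
      by apply: cvg_at_right_filter; exact: cKline.
    by apply: cvg_at_left_filter; exact: cKline.
  + by move=> t _; rewrite derive1E; have [_ ->] := dline t.
- rewrite {}ej in dK KM; rewrite tonelli_rV//.
  transitivity (\int[mu1]_(t in I) (cst M%:E) t)%E; last first.
    by rewrite integral_cst; [rewrite -[RHS]mule1; congr (_ * _)%E; exact: muI|exact:
        measurable_itv].
  rewrite [RHS]integral_mkcond; congr (integral _ _ _); apply/funext => t; rewrite patchE.
  case: ifPn => [/set_mem tI|/negP ntI]; last first.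
    apply: integral0_eq => v _; rewrite /h ifF//; apply/negP => /set_mem /cell_cons[tI _].
    by apply: ntI; apply/mem_set; rewrite /I /= in_itv.
  have tI' : - 2^-1 <= t < 2^-1 by move: tI; rewrite /I /= in_itv.
  transitivity (\int[lebesgue_rV n]_(v in cell) (k (cons_rV (t, v)))%:E)%E.
    rewrite [RHS]integral_mkcond; apply: eq_integral => v _; rewrite patchE /h.
    have -> : (cons_rV (t, v) \in cell) = (v \in cell); last by [].
    apply/idP/idP => /set_mem.
      by move=> /cell_cons[_ cv]; apply/mem_set.
    by move=> cv; apply/mem_set/cell_cons.
  apply: (IH j' (fun v => K (cons_rV (t, v)))).
  + move=> v; apply: (@continuous_comp _ _ _ (fun v => cons_rV (t, v)) k); last exact: ck.
    exact: cons_rV_continuous.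
  + by move=> v cv; apply: k0; apply/cell_cons.
  + move=> v; apply: is_derive_of_line.
    have := dK (cons_rV (t, v) + 0 *: basis_vec (lift ord0 j')).
    case=> dk; rewrite [in k _]scale0r addr0 => <-.
    have := @is_derive_line R n.+1 K (cons_rV (t, v)) (basis_vec (lift ord0 j')) 0 dk.
    by congr (is_derive _ _ _ _); apply/funext => s; rewrite cons_rV_line.
  + by move=> v; rewrite -[X in v + X]scale1r cons_rV_line scale1r KM.
Qed.

Lemma continuous_addf n (f g : 'rV[R]_n -> R) : continuous f -> continuous g ->
  continuous (fun x => f x + g x).
Proof. by move=> cf cg x; exact: (cvgD (cf x) (cg x)). Qed.

Lemma continuous_mulf n (f g : 'rV[R]_n -> R) : continuous f -> continuous g ->
  continuous (fun x => f x * g x).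
Proof. by move=> cf cg x; exact: (cvgM (cf x) (cg x)). Qed.

Lemma continuous_cell_bounded n (w : 'rV[R]_n -> R) : continuous w ->
  exists2 M, 0 <= M & forall x, cell x -> `|w x| <= M.
Proof.
move=> cw.
have cA := @rV_compact R n (fun=> `[(- 2^-1 : R), 2^-1]%classic) (fun=> @segment_compact R _ _).
have := compact_bounded (continuous_compact (continuous_subspaceT cw) cA).
case=> M [_ HM]; exists (`|M| + 1); first by rewrite addr_ge0.
move=> x cx; apply: (HM (`|M| + 1)).
  by rewrite (le_lt_trans (ler_norm _))// ltrDl.
exists x => // j /=; have /andP[h1 h2] := cx j.
by rewrite in_itv /= h1 ltW.
Qed.

Lemma cell_integrable n (w : 'rV[R]_n -> R) : continuous w ->
  (lebesgue_rV n).-integrable cell (EFin \o w).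
Proof.
move=> cw; have [M M0 HM] := continuous_cell_bounded n w cw.
apply: measurable_bounded_integrable.
- exact: measurable_cell.
- have := cell_measure n; move=> e.
  by rewrite [X in (X < _)%E](_ : _ = 1%E) ?ltry//; exact: e.
- by apply: measurable_funTS; exact: continuous_measurable_rV.
- exists M; split; first exact: num_real.
  by move=> N MN x cx; apply: (le_trans (HM x cx)); exact: ltW.
Qed.

(** As u phi is periodic, its j-th derivative h should have mean zero.  The
    function u phi + M x_j has increment M and derivative h + M, which is
    nonnegative when M bounds h on the cell. *)
Lemma cell_integration_by_parts n (j : 'I_n) (u phi : 'rV[R]_n -> R) :
  rC1 u -> rC1 phi -> Defs.periodic u -> Defs.periodic phi ->
  \int[lebesgue_rV n]_(x in cell) (u x * rpartial j phi x) =
  - \int[lebesgue_rV n]_(x in cell) (rpartial j u x * phi x).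
Proof.
move=> u1 p1 pu pp.
have cu := rC1_continuous u u1; have cp := rC1_continuous phi p1.
have c1 : continuous (fun x => u x * rpartial j phi x).
  exact: (continuous_mulf _ _ _ cu (p1 j).2).
have c2 : continuous (fun x => rpartial j u x * phi x).
  exact: (continuous_mulf _ _ _ (u1 j).2 cp).
pose h x := u x * rpartial j phi x + rpartial j u x * phi x.
have ch : continuous h by exact: continuous_addf.
have [M M0 HM] := continuous_cell_bounded n h ch.
have cM : continuous (fun x : 'rV[R]_n => M : R) by move=> x; exact: cst_continuous.
have cMh : continuous (fun x => h x + M) by exact: continuous_addf.
have mc := measurable_cell n.
have shift_int (w : 'rV[R]_n -> R) : Defs.periodic w -> forall x, w (x + basis_vec j) = w x.
  move=> pw x; rewrite -[RHS](pw x (delta_mx ord0 j)); congr (w (_ + _)).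
  by rewrite /rV_of_int map_delta_mx.
have H : (\int[lebesgue_rV n]_(x in cell) (h x + M)%:E = M%:E)%E.
  apply: (@integral_cell_derivative n j (fun x => u x * phi x + M * x ord0 j)) => //.
  - by move=> x /HM; rewrite ler_norml => /andP[]; lra.
  - move=> x.
    have du : is_derive x (basis_vec j) u (rpartial j u x) by exact: DeriveDef ((u1 j).1 _) erefl.
    have dp : is_derive x (basis_vec j) phi (rpartial j phi x) by exact: DeriveDef ((p1 j).1 _)
        erefl.
    have dM : is_derive x (basis_vec j) (fun x : 'rV[R]_n => M * x ord0 j) M.
      apply: is_derive_of_line.
      have -> : (fun t : R => M * (x + t *: basis_vec j) ord0 j) = cst (M * x ord0 j) + M \*: id.
        by apply/funext => t; rewrite !mxE !eqxx mulr1 mulrDr.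
      have := is_deriveD (is_derive_cst (M * x ord0 j) (0 : R) (1 : R))
        (@is_deriveZ _ _ _ id M (0 : R) (1 : R) _ (is_derive_id (0 : R) (1 : R))).
      by rewrite add0r /GRing.scale /= mulr1.
    have := is_deriveD (is_deriveM du dp) dM.
    by rewrite /GRing.scale /= [phi x * _]mulrC.
  - move=> x; rewrite !shift_int// !mxE !eqxx /=; ring.
have i1 := cell_integrable n _ c1; have i2 := cell_integrable n _ c2.
have ih := cell_integrable n _ ch; have iM := cell_integrable n _ cM.
have : \int[lebesgue_rV n]_(x in cell) (h x + M) = M by rewrite /Rintegral H.
rewrite RintegralD// RintegralD//.
have -> : \int[lebesgue_rV n]_(x in cell) M = M.
  rewrite Rintegral_cst//.
  have -> : fine (lebesgue_rV n (cell : set 'rV[R]_n)) = 1 by rewrite (cell_measure n).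
  by rewrite mulr1.
move=> e; apply/eqP; rewrite -addr_eq0; apply/eqP.
by move: e => /(congr1 (fun y => y - M)); rewrite addrK subrr.
Qed.

End cell_integrals.

(** * Lattice sums on dilated cells *)

Section lattice_sums.
Context {R : realType} {d : nat} (d0 : (0 < d)%N).
Implicit Types (u : 'rV[R]_d -> R) (x y : 'rV[R]_d) (lam : R).

(** The periodization of a dilated function, in the variable y = lam x. *)
Definition lattice_sum lam u y := Zsum (fun k => u (y + lam *: rV_of_int k)).

Lemma periodization_scale lam u x :
  periodization (fun x => u (lam *: x)) x = lattice_sum lam u (lam *: x).
Proof. by congr Zsum; apply/funext => k; rewrite scalerDr. Qed.

Lemma norm_rV_of_int_ge1 (k : 'rV[int]_d) : k != 0 -> 1 <= `|rV_of_int k : 'rV[R]_d|.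
Proof.
move=> k0; have [j kj] : exists j, k ord0 j != 0.
  apply/existsP; apply: contra_neqT k0 => /existsPn H; apply/rowP => j.
  by have := H j; rewrite negbK mxE => /eqP.
apply: le_trans (coord_le_norm _ j); rewrite mxE.
by rewrite norm_intr_ge1// ?intr_int// intr_eq0.
Qed.

Lemma norm_le_of_cell lam y : 0 < lam -> cell (lam^-1 *: y) -> `|y| <= lam / 2.
Proof.
move=> l0 cy; apply: norm_le_coord => [|j]; first by rewrite divr_ge0// ltW.
have := cy j; rewrite mxE => /andP[h1 h2].
rewrite ler_norml; apply/andP; split.
  by move: h1; rewrite ler_pdivlMl// mulrN.
by move: h2; rewrite ltr_pdivrMl// => /ltW.
Qed.

(** If y is in the dilated cell then |y| <= lam / 2, whereas lam k has norm at
    least lam when k <> 0.  Hence (1 + |y|) (1 + |k|) <= 4 (1 + |y + lam k|), and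
    the weight at a translate splits into a weight in y and a summable one. *)
Lemma wt_lattice_translate s lam y (k : 'rV[int]_d) : 0 <= s -> 1 <= lam ->
  cell (lam^-1 *: y) ->
  wt s (y + lam *: rV_of_int k) <= 4 `^ s * (wt s y * wt s (rV_of_int k : 'rV[R]_d)).
Proof.
move=> s0 l1 cy; have l0 : 0 < lam by exact: lt_le_trans l1.
pose kk : 'rV[R]_d := rV_of_int k.
(* A scalar whose weight is the product of the weights of y and of k. *)
pose r : R^o := (1 + `|y|) * (1 + `|kk|) - 1.
have y0 := normr_ge0 y; have k0 := normr_ge0 kk.
have rE : 1 + `|r| = (1 + `|y|) * (1 + `|kk|).
  by rewrite ger0_norm ?/r; [rewrite addrC subrK|nra].
have -> : wt s y * wt s (rV_of_int k : 'rV[R]_d) = wt s r.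
  by rewrite /wt rE powRM// addr_ge0.
apply: wt_comp => //; rewrite rE -/kk.
have yl := norm_le_of_cell _ _ l0 cy.
have [e|kn0] := eqVneq k 0.
  have -> : kk = 0 by rewrite /kk e /rV_of_int map_mx0.
  rewrite normr0 scaler0 !addr0 mulr1 ler_peMl ?ler1n//.
have k1 : 1 <= `|kk| by exact: norm_rV_of_int_ge1.
have h := ler_normB (y + lam *: kk) y.
move: h; rewrite [X in `|X| <= _]addrAC subrr add0r normrZ (gtr0_norm l0) => h.
nra.
Qed.

Lemma lattice_sum_bound s u : d%:R < s -> decays s u ->
  exists2 C, 0 <= C & forall lam y, 1 <= lam -> cell (lam^-1 *: y) ->
    `|lattice_sum lam u y| <= C * wt s y.
Proof.
move=> ds [K uK]; have s0 : 0 <= s by rewrite (le_trans _ (ltW ds)).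
have K0 : 0 <= K by have := le_trans (normr_ge0 _) (uK 0); rewrite pmulr_lge0// wt_gt0.
pose S := abs_total (fun k : 'rV[int]_d => wt s (rV_of_int k : 'rV[R]_d)).
exists (K * 4 `^ s * S) => [|lam y l1 cy].
  by rewrite !mulr_ge0 ?powR_ge0// abs_total_ge0.
have sM := abs_summableZ (K * 4 `^ s * wt s y) _ (wt_summable d0 s ds).
have H k : `|u (y + lam *: rV_of_int k)| <= K * 4 `^ s * wt s y * wt s (rV_of_int k : 'rV[R]_d).
  rewrite (le_trans (uK _))// -!mulrA ler_wpM2l//.
  exact: wt_lattice_translate.
apply: (le_trans (Zsum_norm _ (abs_summable_le _ _ sM H))).
apply: (le_trans (abs_total_le _ _ sM H)).
have -> : abs_total (fun k : 'rV[int]_d => K * 4 `^ s * wt s y * wt s (rV_of_int k : 'rV[R]_d)) =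
   (K * 4 `^ s * wt s y) * S.
  have pos (a : 'rV[int]_d -> R) : (forall k, 0 <= a k) -> abs_summable a -> abs_total a = Zsum a.
    move=> a0 sa; rewrite Zsum_posneg//.
    have -> : abs_total (fun k => Num.max (- a k) 0) = 0.
      rewrite /abs_total esum1// => k _; congr EFin; rewrite max_r ?normr0//.
      by rewrite oppr_le0.
    rewrite subr0; congr abs_total; apply/funext => k; rewrite max_l//.
  rewrite pos//; last by move=> k; rewrite !mulr_ge0 ?powR_ge0.
  rewrite ZsumZ ?/S ?pos//; try exact: wt_summable.
  by move=> k; exact: wt_ge0.
by rewrite -!mulrA (mulrC (wt s y)).
Qed.

Lemma cell_near_pinfty y : \forall lam \near +oo, cell (lam^-1 *: y).
Proof.
near=> lam.
have l0 : 0 < lam by near: lam; exact: nbhs_pinfty_gt.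
have yl : 2 * `|y| < lam by near: lam; apply: nbhs_pinfty_gt; rewrite num_real.
move=> j; rewrite mxE.
have := coord_le_norm y j; rewrite ler_norml => /andP[h1 h2].
apply/andP; split; first by rewrite ler_pdivlMl//; lra.
by rewrite ltr_pdivrMl//; lra.
Unshelve. all: by end_near. Qed.

(** Every term but the one at k = 0 escapes to infinity. *)
Lemma lattice_sum_cvg s u y : d%:R < s -> decays s u ->
  lattice_sum lam u y @[lam --> +oo] --> u y.
Proof.
move=> ds [K uK]; have s0 : 0 <= s by rewrite (le_trans _ (ltW ds)).
have s1 : 1 <= s by rewrite (le_trans _ (ltW ds))// ler1n.
have K0 : 0 <= K by have := le_trans (normr_ge0 _) (uK 0); rewrite pmulr_lge0// wt_gt0.
rewrite -(Zsum_delta (d := d) (u y)).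
apply: (Zsum_cvg _ _ _ _ (abs_summableZ (K * 4 `^ s * wt s y) _ (wt_summable d0 s ds))).
  near=> lam => k.
  rewrite (le_trans (uK _))// -!mulrA ler_wpM2l//.
  apply: wt_lattice_translate => //.
  by near: lam; exact: cell_near_pinfty.
move=> k; case: eqVneq => [->|k0].
  have -> : (fun lam : R => u (y + lam *: rV_of_int 0)) = fun=> u y.
    by apply/funext => lam; rewrite /rV_of_int map_mx0 scaler0 addr0.
  exact: cvg_cst.
apply/cvgrPdist_lt => e e0; near=> lam.
have l0 : 0 < lam by near: lam; exact: nbhs_pinfty_gt.
rewrite sub0r normrN (le_lt_trans (uK _))//.
have lK : `|y| + K / e < lam by near: lam; apply: nbhs_pinfty_gt; rewrite num_real.
have k1 := norm_rV_of_int_ge1 k k0.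
have h := ler_normB (y + lam *: rV_of_int k) y.
move: h; rewrite [X in `|X| <= _]addrAC subrr add0r normrZ (gtr0_norm l0) => h.
apply: (@le_lt_trans _ _ (K * wt 1 (y + lam *: rV_of_int k))).
  by rewrite ler_wpM2l// wt_anti.
rewrite /wt powR_inv1; last by rewrite addr_ge0.
rewrite ltr_pdivrMr ?wt_base_gt0// -ltr_pdivrMl// mulrC.
have := ler_wpM2l (ltW l0) k1; lra.
Unshelve. all: by end_near. Qed.

End lattice_sums.

Section dilated_cells.
Context {R : realType} {d : nat} (d0 : (0 < d)%N).

Lemma integral_dilation (c : R) (h : 'rV[R]_d -> \bar R) : 0 < c ->
  measurable_fun [set: 'rV[R]_d] h ->
  (\int[lebesgue_rV d]_x h x = \int[lebesgue_rV d]_x ((c ^+ d)%:E * h (c *: x)%R))%E.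
Proof.
move=> c0 mh; rewrite integralE [RHS]integralE.
have cd : 0 <= c ^+ d by rewrite exprn_ge0// ltW.
have ge0 (g : 'rV[R]_d -> \bar R) : measurable_fun [set: 'rV[R]_d] g -> (forall x, (0 <= g x)%E) ->
    (\int[lebesgue_rV d]_x g x = \int[lebesgue_rV d]_x ((c ^+ d)%:E * g (c *: x)%R))%E.
  move=> mg g0; rewrite (integral_scale_rV d c)// ge0_integralZl//.
  by apply: measurableT_comp => //; exact: measurable_scaler.
rewrite (ge0_funeposM (fun x => h (c *: x)) cd) (ge0_funenegM (fun x => h (c *: x)) cd).
rewrite ge0//; last exact: measurable_funepos.
rewrite [X in (_ - X)%E]ge0//; last exact: measurable_funeneg.
by congr (_ - _)%E; apply: eq_integral => x _; rewrite ?funeposE ?funenegE.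
Qed.

Lemma Rintegral_cell_dilation (c : R) (w : 'rV[R]_d -> R) : 0 < c ->
  measurable_fun [set: 'rV[R]_d] w ->
  \int[lebesgue_rV d]_(x in cell) (c ^+ d * w (c *: x)) =
  \int[lebesgue_rV d]_(y in [set y | cell (c^-1 *: y)]) w y.
Proof.
move=> c0 mw; rewrite /Rintegral; congr fine; rewrite integral_mkcond [RHS]integral_mkcond.
have mD : measurable [set y : 'rV[R]_d | cell (c^-1 *: y)].
  rewrite -[X in measurable X]setTI; apply: measurable_scaler => //.
  exact: measurable_cell.
rewrite [RHS](integral_dilation c)//; last first.
  apply/(measurable_restrictT _ mD).
  by apply/measurable_EFinP; exact: measurable_funTS.
apply: eq_integral => x _; rewrite !patchE.
have -> : (c *: x \in [set y | cell (c^-1 *: y)]) = (x \in cell).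
  by apply/idP/idP => /set_mem /= H; apply/mem_set => /=; move: H; rewrite scalerA mulVf
      ?scale1r ?gt_eqF.
by case: ifP => _; rewrite ?EFinM ?mule0.
Qed.

(** With y = lam x the dilated cells exhaust the space, and the envelope C wt s
    allows dominated convergence. *)
Lemma cvg_dilated_cell (G : R -> 'rV[R]_d -> R) (g : 'rV[R]_d -> R) (C s : R) :
  d%:R < s -> (forall lam, 1 <= lam -> measurable_fun [set: 'rV[R]_d] (G lam)) ->
  measurable_fun [set: 'rV[R]_d] g ->
  (forall lam y, 1 <= lam -> cell (lam^-1 *: y) -> `|G lam y| <= C * wt s y) ->
  (forall y, G lam y @[lam --> +oo] --> g y) ->
  \int[lebesgue_rV d]_(x in cell) (lam ^+ d * G lam (lam *: x)) @[lam --> +oo] -->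
    \int[lebesgue_rV d]_x g x.
Proof.
move=> ds mG mg GC Gg.
have C0 : 0 <= C.
  have := le_trans (normr_ge0 _) (GC 1 0 (lexx _) _); rewrite pmulr_lge0 ?wt_gt0//; apply.
  by move=> j; rewrite scaler0 mxE; apply/andP; split; lra.
apply/cvg_pinftyP => u uoo.
(* The envelope is available for lam >= 1 only. *)
pose v n := Num.max (u n) 1.
have v1 n : 1 <= v n by rewrite /v le_max lexx orbT.
have uv : \forall n \near \oo, u n = v n.
  have : \forall n \near \oo, 1 <= u n by exact: (uoo _ (nbhs_pinfty_ge (num_real (1 : R)))).
  by apply: filterS => n un; rewrite /v max_l.
have voo : v n @[n --> \oo] --> +oo.
  by apply: cvg_trans uoo; apply: near_eq_cvg; near=> n; near: n; apply: filterS uv => n ->.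
suff : (\int[lebesgue_rV d]_(x in cell) (v n ^+ d * G (v n) (v n *: x))) @[n --> \oo] -->
    \int[lebesgue_rV d]_x g x.
  by apply: cvg_trans; apply: near_eq_cvg; apply: filterS uv => n ->.
have dil n : \int[lebesgue_rV d]_(x in cell) (v n ^+ d * G (v n) (v n *: x)) =
    \int[lebesgue_rV d]_(y in [set y | cell ((v n)^-1 *: y)]) G (v n) y.
  by apply: Rintegral_cell_dilation; [exact: lt_le_trans (v1 n)|exact: mG].
rewrite (funext dil).
pose D n := [set y : 'rV[R]_d | cell ((v n)^-1 *: y)].
have mD n : measurable (D n).
  rewrite -[X in measurable X]setTI; apply: measurable_scaler => //.
  exact: measurable_cell.
apply: fine_cvg.
pose F n := (EFin \o G (v n)) \_ (D n).
have [] := @dominated_convergence _ _ _ (lebesgue_rV d) setT measurableT F (EFin \o g)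
   (EFin \o (fun y => C * wt s y)).
- move=> n; apply/(measurable_restrictT _ (mD n)).
  by apply/measurable_EFinP; apply: measurable_funTS; exact: mG.
- exact/measurable_EFinP.
- apply: aeW => y _ /=.
  have cG : (G (v n) y)%:E @[n --> \oo] --> (g y)%:E.
    apply: cvg_EFin; first exact: nearW.
    by move: (Gg y) => /cvg_pinftyP /(_ _ voo).
  apply: cvg_trans cG; apply: near_eq_cvg.
  have : \forall n \near \oo, cell ((v n)^-1 *: y) by exact: (voo _ (cell_near_pinfty y)).
  by apply: filterS => n cn; rewrite /F patchE ifT//; exact: mem_set.
- have := integrableZl measurableT C (wt_integrable d0 s ds).
  by apply: eq_integrable.
- apply: aeW => y n _ /=; rewrite /F patchE; case: ifPn => [/set_mem cy|_] /=.
    by rewrite lee_fin; exact: GC.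
  by rewrite normr0 lee_fin mulr_ge0// wt_ge0.
move=> ig _ H; rewrite fineK; last exact: integrable_fin_num ig.
have -> : (fun n => \int[lebesgue_rV d]_(x in [set y | cell ((v n)^-1 *: y)]) (G (v n) x)%:E)%E =
  (fun n => \int[lebesgue_rV d]_x F n x)%E.
  by apply/funext => n; rewrite integral_mkcond.
exact: H.
Unshelve. all: by end_near. Qed.

End dilated_cells.

(** * Families approximating a function on dilated cells *)

Section decay.
Context {R : realType} {d : nat}.
Implicit Types (u : 'rV[R]_d -> R) (x : 'rV[R]_d).

Lemma norm_le_enorm x : `|x| <= enorm x.
Proof.
apply: norm_le_coord => [|j]; first exact: sqrtr_ge0.
rewrite -sqrtr_sqr ler_wsqrtr// /dotp (bigD1 j)//= -expr2 lerDl.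
by apply: sumr_ge0 => i _; rewrite -expr2 sqr_ge0.
Qed.

Lemma enorm_sqr_le x : enorm x ^+ 2 <= d%:R * `|x| ^+ 2.
Proof.
rewrite sqr_sqrtr; last by apply: sumr_ge0 => i _; rewrite -expr2 sqr_ge0.
have -> : d%:R * `|x| ^+ 2 = \sum_(j < d) `|x| ^+ 2.
  by rewrite sumr_const card_ord mulr_natl.
apply: ler_sum => j _; rewrite -expr2 -[leLHS]ger0_norm ?sqr_ge0// normrX lerXn2r ?nnegrE//.
exact: coord_le_norm.
Qed.

(** The power bound is void near the origin, where compactness replaces it. *)
Lemma decays_of_power_decay u (C s : R) : 0 <= C -> 0 <= s -> continuous u ->
  (forall x, x != 0 -> `|u x| <= C / enorm x `^ s) -> decays s u.
Proof.
move=> C0 s0 cu uC.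
have cA := @rV_compact R d (fun=> `[(- 1 : R), 1]%classic) (fun=> @segment_compact R _ _).
have [M [_ HM]] := compact_bounded (continuous_compact (continuous_subspaceT cu) cA).
have M1 x : `|x| <= 1 -> `|u x| <= `|M| + 1.
  move=> x1; apply: (HM (`|M| + 1)); first by rewrite (le_lt_trans (ler_norm _))// ltrDl.
  exists x => // j /=; have := coord_le_norm x j => /le_trans/(_ x1).
  by rewrite in_itv /= ler_norml.
exists ((C + (`|M| + 1)) * 2 `^ s) => x; rewrite -mulrA.
have Mp : 0 <= `|M| + 1 by rewrite addr_ge0.
have [x1|x1] := leP `|x| 1.
  apply: (le_trans (M1 x x1)); rewrite -[leLHS]mulr1 ler_pM//; first by rewrite lerDr.
  have := @wt_comp R R^o _ s 2 x (0 : R^o) s0.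
  rewrite {1}/wt normr0 addr0 powR1; apply=> //.
  by rewrite mulr1; lra.
have x0 : x != 0 by rewrite -normr_gt0 (lt_trans _ x1).
apply: (le_trans (uC x x0)); rewrite ler_pM// ?invr_ge0 ?powR_ge0 ?lerDl//.
rewrite /wt powRN ler_pdivlMr ?powR_gt0 ?wt_base_gt0//.
have e0 : 0 < enorm x by rewrite (lt_le_trans _ (norm_le_enorm x))// (lt_trans _ x1).
rewrite mulrC ler_pdivrMr ?powR_gt0// -powRM ?(ltW e0)//.
apply: ge0_ler_powR; rewrite ?nnegrE ?mulr_ge0 ?addr_ge0 ?(ltW e0)//.
have := norm_le_enorm x; lra.
Qed.

End decay.

Lemma continuous_comp_scaler {R : realType} {d : nat} (c : R) (w : 'rV[R]_d -> R) :
  continuous w -> continuous (fun y : 'rV[R]_d => w (c *: y)).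
Proof.
move=> cw y; apply: (@continuous_comp _ _ _ (fun y : 'rV[R]_d => c *: y) w); last exact: cw.
exact: scaler_continuous.
Qed.

Section approximations.
Context {R : realType} {d : nat} (d0 : (0 < d)%N).
Implicit Types (U V : R -> 'rV[R]_d -> R) (u v : 'rV[R]_d -> R) (s t : R).

(** Pointwise convergence as lam tends to infinity, with an envelope of order s
    on the dilated cells.  Orders add up in products, so that the growth of a
    factor is paid for by the decay of the other ones; for s > d the integrals
    over the dilated cells converge. *)
Definition approximates s U u := [/\
  forall lam, 1 <= lam -> continuous (U lam),
  continuous u,
  exists2 C, 0 <= C &
    forall lam y, 1 <= lam -> cell (lam^-1 *: y) -> `|U lam y| <= C * wt s y &
  forall y, U lam y @[lam --> +oo] --> u y].

Lemma approximates_lattice_sum s u : d%:R < s -> continuous u -> decays s u ->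
  approximates s (fun lam => lattice_sum lam u) u.
Proof.
move=> ds cu us; split => //; [|exact: lattice_sum_bound|by move=> y; exact: (lattice_sum_cvg
    d0 s)].
move=> lam l1; have l0 : 0 < lam by exact: lt_le_trans l1.
have s0 : 0 <= s by rewrite (le_trans _ (ltW ds)).
have -> : lattice_sum lam u = (fun y => periodization (fun x => u (lam *: x)) (lam^-1 *: y)).
  by apply/funext => y; rewrite periodization_scale scalerA divff ?gt_eqF// scale1r.
apply: (continuous_comp_scaler lam^-1).
apply: (periodization_continuous d0 s) => //; first exact: decays_scale.
exact: (continuous_comp_scaler lam).
Qed.

Lemma approximatesD s U V u v : approximates s U u -> approximates s V v ->
  approximates s (fun lam y => U lam y + V lam y) (fun y => u y + v y).
Proof.
move=> [cU cu [C C0 HC] Uu] [cV cv [D D0 HD] Vv]; split.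
- by move=> lam l1; apply: continuous_addf; [exact: cU|exact: cV].
- exact: continuous_addf.
- exists (C + D) => [|lam y l1 cy]; first by rewrite addr_ge0.
  by rewrite (le_trans (ler_normD _ _))// mulrDl lerD ?HC ?HD.
- by move=> y; exact: (cvgD (Uu y) (Vv y)).
Qed.

Lemma approximatesM s t U V u v : approximates s U u -> approximates t V v ->
  approximates (s + t) (fun lam y => U lam y * V lam y) (fun y => u y * v y).
Proof.
move=> [cU cu [C C0 HC] Uu] [cV cv [D D0 HD] Vv]; split.
- by move=> lam l1; apply: continuous_mulf; [exact: cU|exact: cV].
- exact: continuous_mulf.
- exists (C * D) => [|lam y l1 cy]; first by rewrite mulr_ge0.
  by rewrite normrM wtD mulrACA ler_pM ?HC ?HD.
- by move=> y; exact: (cvgM (Uu y) (Vv y)).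
Qed.

Lemma approximates_cst s (c : R) : s <= 0 ->
  approximates s (fun=> fun=> c) (fun=> c).
Proof.
move=> s0; split; [by move=> lam _ x; exact: cst_continuous|by move=> x; exact: cst_continuous|
    |by move=> y; exact: cvg_cst].
exists `|c| => // lam y _ _; rewrite -[leLHS]mulr1 ler_wpM2l//.
by rewrite /wt -[leLHS](@powRr0 R (1 + `|y|)) ler_powR ?lerDl// oppr_ge0.
Qed.

Lemma approximatesZ s c U u : approximates s U u ->
  approximates s (fun lam y => c * U lam y) (fun y => c * u y).
Proof.
by move=> Uu; rewrite -[s]add0r; apply: approximatesM => //; exact: approximates_cst.
Qed.

Lemma approximates_sum s (J : finType) (U : J -> R -> 'rV[R]_d -> R)
    (u : J -> 'rV[R]_d -> R) :
  (forall j, approximates s (U j) (u j)) ->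
  approximates s (fun lam y => \sum_j U j lam y) (fun y => \sum_j u j y).
Proof.
move=> Uu; rewrite /index_enum; elim: (locked_with _ _) => [|j r IH].
  split.
  - by move=> lam _; under eq_fun do rewrite big_nil; move=> x; exact: cst_continuous.
  - by under eq_fun do rewrite big_nil; move=> x; exact: cst_continuous.
  - by exists 0 => // lam y _ _; rewrite big_nil normr0 mul0r.
  - by move=> y; under eq_fun do rewrite big_nil; rewrite big_nil; exact: cvg_cst.
have -> : (fun lam y => \sum_(i <- j :: r) U i lam y) =
    (fun lam y => U j lam y + \sum_(i <- r) U i lam y).
  by apply/funext => lam; apply/funext => y; rewrite big_cons.
have -> : (fun y => \sum_(i <- j :: r) u i y) = (fun y => u j y + \sum_(i <- r) u i y).
  by apply/funext => y; rewrite big_cons.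
exact: approximatesD.
Qed.

Lemma approximates_integral s U u : d%:R < s -> approximates s U u ->
  \int[lebesgue_rV d]_(x in cell) (lam ^+ d * U lam (lam *: x)) @[lam --> +oo] -->
    \int[lebesgue_rV d]_x u x.
Proof.
move=> ds [cU cu [C C0 HC] Uu]; apply: (cvg_dilated_cell d0 _ _ C s ds) => //.
  by move=> lam l1; apply: continuous_measurable_rV; exact: cU.
exact: continuous_measurable_rV.
Qed.

Lemma approximates_cell_integrable s U u lam (c : R) : approximates s U u -> 1 <= lam ->
  (lebesgue_rV d).-integrable cell (EFin \o (fun x => c * U lam (lam *: x))).
Proof.
move=> [cU _ _ _] l1; apply: cell_integrable.
apply: continuous_mulf; first by move=> x; exact: cst_continuous.
by apply: continuous_comp_scaler; exact: cU.
Qed.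

End approximations.

Section trigonometric_weights.
Context {R : realType} {d : nat}.
Implicit Types (x y : 'rV[R]_d).

Lemma norm_sin_le (t : R) : `|sin t| <= `|t|.
Proof.
wlog t0 : t / 0 <= t => [H|].
  by have [/H//|/ltW t0] := leP 0 t; rewrite -normrN -sinN -(normrN t) H// oppr_ge0.
have [c _] := @MVT_segment R sin cos 0 t t0 (fun r _ => is_derive_sin r)
  (continuous_subspaceT (@continuous_sin R)).
by rewrite sin0 !subr0 => ->; rewrite normrM ler_piMl// ler_norml cos_geN1 cos_le1.
Qed.

Lemma dotp_continuous (L : 'rV[R]_d) : continuous (dotp L).
Proof.
rewrite /dotp /index_enum; elim: (locked_with _ _) => [|j r IH].
  by under eq_fun do rewrite big_nil; move=> y; exact: cst_continuous.
under eq_fun do rewrite big_cons; apply: continuous_addf => //.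
apply: continuous_mulf; first by move=> y; exact: cst_continuous.
by move=> y; exact: coord_continuous.
Qed.

Lemma norm_dotp_le (L y : 'rV[R]_d) : `|dotp L y| <= (\sum_j `|L ord0 j|) * `|y|.
Proof.
rewrite (le_trans (ler_norm_sum _ _ _))// mulr_suml ler_sum// => j _.
by rewrite normrM ler_wpM2l// coord_le_norm.
Qed.

Lemma sin_scaled_cvg (t c : R) : 0 < c ->
  c * lam * sin (t / (c * lam)) @[lam --> +oo] --> t.
Proof.
move=> c0.
have h1 : is_derive (0 : R) (1 : R) (fun h : R => t * h) t.
  have := @is_deriveZ _ _ _ id t (0 : R) (1 : R) _ (is_derive_id (0 : R) (1 : R)).
  by rewrite /GRing.scale /= mulr1.
have h2 := @is_derive_sin R (t * 0).
have [] := @is_derive1_comp _ _ _ _ _ _ h2 h1.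
rewrite mulr0 cos0 mul1r => ds Ds.
have lim : h^-1 * sin (t * h) @[h --> (0 : R)^'] --> t.
  have : h^-1 *: (((sin \o (fun h => t * h)) \o shift 0) (h *: (1 : R)) - (sin \o (fun h => t *
      h)) 0) @[h --> (0 : R)^'] --> t.
    by rewrite -[X in _ --> X]Ds; exact: ds.
  apply: cvg_trans; apply: near_eq_cvg; near=> h.
  by rewrite /GRing.scale /= mulr1 addr0 mulr0 sin0 subr0.
have inv0 : (c * lam)^-1 @[lam --> +oo] --> (0 : R)^'.
  move=> P [e /= e0 eP].
  suff : \forall lam \near +oo, P (c * lam)^-1 by [].
  near=> lam.
  have l0 : 0 < lam by near: lam; exact: nbhs_pinfty_gt.
  have cl : 0 < c * lam by rewrite mulr_gt0.
  apply: eP; last by rewrite /= invr_eq0 gt_eqF.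
  rewrite /= sub0r normrN gtr0_norm ?invr_gt0// invf_plt ?posrE//.
  rewrite -ltr_pdivrMl//; near: lam; apply: nbhs_pinfty_gt; rewrite num_real//.
have -> : (fun lam => c * lam * sin (t / (c * lam))) =
    (fun h => h^-1 * sin (t * h)) \o (fun lam => (c * lam)^-1).
  by apply/funext => lam /=; rewrite invrK.
exact: (cvg_comp _ _ inv0 lim).
Unshelve. all: by end_near. Qed.

(** As |sin t| <= |t|, the family grows at most linearly: its order is -1. *)
Lemma approximates_sin (L : 'rV[R]_d) (c : R) : 0 < c ->
  approximates (- 1) (fun lam y => c * lam * sin (2 * pi * dotp L y / (c * lam)))
    (fun y => 2 * pi * dotp L y).
Proof.
move=> c0.
have cL : continuous (fun y => 2 * pi * dotp L y).
  move=> y; apply: (@continuous_comp _ _ _ (dotp L) ( *%R (2 * pi))).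
    exact: dotp_continuous.
  exact: mulrl_continuous.
split => //.
- move=> lam _ y.
  apply: (@continuous_comp _ _ _ (fun y => sin (2 * pi * dotp L y / (c * lam))) ( *%R (c *
      lam))); last exact: mulrl_continuous.
  apply: (@continuous_comp _ _ _ (fun y => 2 * pi * dotp L y / (c * lam)) sin); last exact:
      continuous_sin.
  apply: (@continuous_comp _ _ _ (fun y => 2 * pi * dotp L y) ( *%R^~ (c * lam)^-1)); last
      exact: mulrr_continuous.
  exact: cL.
- exists (2 * pi * \sum_j `|L ord0 j|).
    by rewrite mulr_ge0 ?sumr_ge0// mulr_ge0// pi_ge0.
  move=> lam y l1 _; have cl : 0 < c * lam by rewrite mulr_gt0// (lt_le_trans _ l1).
  rewrite normrM (gtr0_norm cl).
  apply: (@le_trans _ _ (c * lam * `|2 * pi * dotp L y / (c * lam)|)).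
    by rewrite ler_wpM2l ?(ltW cl)// norm_sin_le.
  rewrite normrM normfV (gtr0_norm cl) mulrCA mulfV ?gt_eqF// mulr1.
  have p0 : 0 <= 2 * pi :> R by rewrite mulr_ge0// pi_ge0.
  rewrite normrM (ger0_norm p0) -[leRHS]mulrA ler_wpM2l//.
  rewrite (le_trans (norm_dotp_le _ _))// ler_wpM2l ?sumr_ge0//.
  by rewrite /wt opprK powRr1 ?addr_ge0// lerDr.
- by move=> y; exact: sin_scaled_cvg.
Qed.

End trigonometric_weights.

(** * The periodization of a complex function *)

Section complex_parts.
Context {R : realType}.
Local Open Scope complex_scope.
Local Notation normc := ComplexField.Normc.normc.
Implicit Types z w : R[i].

Lemma normc_sqr z : normc z ^+ 2 = complex.Re z * complex.Re z + complex.Im z * complex.Im z.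
Proof.
by case: z => a b /=; rewrite sqr_sqrtr ?addr_ge0 ?sqr_ge0// !expr2.
Qed.

Lemma norm_Re_le z : `|complex.Re z| <= normc z.
Proof.
rewrite -(@ler_pXn2r _ 2) ?nnegrE//; last by case: z => a b; rewrite /= sqrtr_ge0.
by rewrite normc_sqr real_normK ?num_real// expr2 lerDl -expr2 sqr_ge0.
Qed.

Lemma norm_Im_le z : `|complex.Im z| <= normc z.
Proof.
rewrite -(@ler_pXn2r _ 2) ?nnegrE//; last by case: z => a b; rewrite /= sqrtr_ge0.
by rewrite normc_sqr real_normK ?num_real// expr2 lerDr -expr2 sqr_ge0.
Qed.

Lemma Re_mul z w : complex.Re (z * w) = complex.Re z * complex.Re w - complex.Im z * complex.Im w.
Proof. by case: z w => [a b] [c e]. Qed.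

Lemma Im_mul z w : complex.Im (z * w) = complex.Re z * complex.Im w + complex.Im z * complex.Re w.
Proof. by case: z w => [a b] [c e]. Qed.

Lemma Re_conj z : complex.Re (z^*) = complex.Re z.
Proof. by case: z. Qed.

Lemma Im_conj z : complex.Im (z^*) = - complex.Im z.
Proof. by case: z. Qed.

Lemma Re_real_mul (r : R) z : complex.Re (r%:C * z) = r * complex.Re z.
Proof. by case: z => a b /=; rewrite mul0r subr0. Qed.

Lemma Im_real_mul (r : R) z : complex.Im (r%:C * z) = r * complex.Im z.
Proof. by case: z => a b /=; rewrite mul0r addr0. Qed.

Lemma Re_sum (I : Type) (r : seq I) (F : I -> R[i]) :
  complex.Re (\sum_(i <- r) F i) = \sum_(i <- r) complex.Re (F i).
Proof. by elim/big_rec2 : _ => // i x y _ <-; case: (F i) => a b; case: y => c e. Qed.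

Lemma Im_sum (I : Type) (r : seq I) (F : I -> R[i]) :
  complex.Im (\sum_(i <- r) F i) = \sum_(i <- r) complex.Im (F i).
Proof. by elim/big_rec2 : _ => // i x y _ <-; case: (F i) => a b; case: y => c e. Qed.

Context {d : nat}.
Implicit Types (f g : 'rV[R]_d -> R[i]) (x : 'rV[R]_d).

Lemma Re_dderiv D test (L : 'rV[R]_d) g x : cC1 g ->
  complex.Re (dderiv D test L g x) = \sum_j L ord0 j * rpartial j (Re_fun g) x.
Proof.
move=> g1; rewrite /dderiv Re_sum; apply: eq_bigr => j _.
by rewrite Re_real_mul /partial; case: asboolP.
Qed.

Lemma Im_dderiv D test (L : 'rV[R]_d) g x : cC1 g ->
  complex.Im (dderiv D test L g x) = \sum_j L ord0 j * rpartial j (Im_fun g) x.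
Proof.
move=> g1; rewrite /dderiv Im_sum; apply: eq_bigr => j _.
by rewrite Im_real_mul /partial; case: asboolP.
Qed.

Lemma L2norm_sqr D g : L2norm D g ^+ 2 =
  \int[lebesgue_rV d]_(x in D) (Re_fun g x * Re_fun g x + Im_fun g x * Im_fun g x).
Proof.
rewrite /L2norm sqr_sqrtr; last by apply: Rintegral_ge0 => x _; rewrite sqr_ge0.
by apply: eq_Rintegral => x _; rewrite normc_sqr.
Qed.

Lemma in_L2_cell g : continuous (Re_fun g) -> continuous (Im_fun g) -> in_L2 cell g.
Proof.
move=> cr ci; split.
- by apply: measurable_funTS; exact: continuous_measurable_rV.
- by apply: measurable_funTS; exact: continuous_measurable_rV.
have cn : continuous (fun x => Re_fun g x * Re_fun g x + Im_fun g x * Im_fun g x).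
  by apply: continuous_addf; apply: continuous_mulf.
have /integrableP[_] := cell_integrable d _ cn.
apply: le_lt_trans; apply: ge0_le_integral => //.
- exact: measurable_cell.
- by move=> x _; rewrite lee_fin sqr_ge0.
- apply/measurable_EFinP; apply: measurable_funTS; apply: continuous_measurable_rV.
  by rewrite (_ : (fun x => _) = (fun x => Re_fun g x * Re_fun g x + Im_fun g x * Im_fun g x))//;
    apply/funext => x; rewrite normc_sqr.
- apply: measurableT_comp => //; apply/measurable_EFinP; apply: measurable_funTS.
  exact: continuous_measurable_rV.
- by move=> x _ /=; rewrite lee_fin normc_sqr ler_norm.
Qed.

Lemma cC1_in_H1_Td g : cC1 g -> Defs.periodic (Re_fun g) -> Defs.periodic (Im_fun g) ->
  in_H1_Td g.
Proof.
move=> [r1 i1] pr pi; split.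
  move=> x k; have := pr x k; have := pi x k; rewrite /Re_fun /Im_fun.
  by case: (g _) (g _) => [a b] [c e] /= -> ->.
split; first by apply: in_L2_cell; exact: rC1_continuous.
move=> j; exists (cpartial j g); split.
  by apply: in_L2_cell; [exact: (r1 j).2|exact: (i1 j).2].
move=> phi [sphi pphi]; have p1 := sphi [::].
rewrite /cintegral.
have E (h : 'rV[R]_d -> R[i]) (u : 'rV[R]_d -> R) :
    (Re_fun (fun x => h x * (u x)%:C) = fun x => Re_fun h x * u x) /\
    (Im_fun (fun x => h x * (u x)%:C) = fun x => Im_fun h x * u x).
  by split; apply/funext => x; rewrite /Re_fun /Im_fun mulrC ?Re_real_mul ?Im_real_mul mulrC.
rewrite (E g _).1 (E g _).2 (E (cpartial j g) _).1 (E (cpartial j g) _).2.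
rewrite (cell_integration_by_parts d j _ _ r1 p1 pr pphi).
by rewrite (cell_integration_by_parts d j _ _ i1 p1 pi pphi).
Qed.

End complex_parts.

Section periodize.
Context {R : realType} {d : nat} (d0 : (0 < d)%N).
Implicit Types (u : 'rV[R]_d -> R) (f : 'rV[R]_d -> R[i]).

Lemma decays_anti s t u : s <= t -> decays t u -> decays s u.
Proof.
move=> st [K uK]; exists K => x; apply: (le_trans (uK x)).
have K0 : 0 <= K by have := le_trans (normr_ge0 _) (uK x); rewrite pmulr_lge0// wt_gt0.
by rewrite ler_wpM2l// wt_anti.
Qed.

Lemma decays_cmul s (c : R) u : decays s u -> decays s (fun x => c * u x).
Proof.
by move=> [K uK]; exists (`|c| * K) => x; rewrite normrM -mulrA ler_wpM2l.
Qed.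

Lemma Re_periodize lam f x : Re_fun (periodize lam f) x =
  Num.sqrt (lam ^+ d) * lattice_sum lam (Re_fun f) (lam *: x).
Proof.
rewrite /Re_fun /periodize Re_real_mul; congr (_ * Zsum _).
by apply/funext => k; rewrite scalerDr.
Qed.

Lemma Im_periodize lam f x : Im_fun (periodize lam f) x =
  Num.sqrt (lam ^+ d) * lattice_sum lam (Im_fun f) (lam *: x).
Proof.
rewrite /Im_fun /periodize Im_real_mul; congr (_ * Zsum _).
by apply/funext => k; rewrite scalerDr.
Qed.

Lemma dilated_lattice_sum_rC1 s lam u (c : R) : d%:R < s -> 0 < lam -> rC1 u ->
  decays s u -> (forall j, decays s (rpartial j u)) ->
  let g := fun x => c * lattice_sum lam u (lam *: x) in
  [/\ rC1 g, Defs.periodic g &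
    forall j x, rpartial j g x = c * (lam * lattice_sum lam (rpartial j u) (lam *: x))].
Proof.
move=> ds l0 u1 us dus g; have s0 : 0 <= s by rewrite (le_trans _ (ltW ds)).
have [v1 dv] := rC1_scale u lam u1.
have vs := decays_scale s lam u s0 l0 us.
have dvs j : decays s (rpartial j (fun x => u (lam *: x))).
  by rewrite dv; apply: decays_cmul; exact: (decays_scale s lam).
have [p1 dp] := periodization_rC1 d0 s _ ds v1 vs dvs.
have [g1 dg] := rC1_cmul _ c p1.
have gE : g = (fun x => c * periodization (fun x => u (lam *: x)) x).
  by apply/funext => x; rewrite periodization_scale.
rewrite gE; split => //.
  by move=> x k; rewrite periodization_periodic.
move=> j x; rewrite dg dp dv; congr (_ * _).
rewrite -periodization_scale /periodization ZsumZ//.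
exact: (periodization_summable d0 s (fun x => rpartial j u (lam *: x)) x ds
  (decays_scale s lam _ s0 l0 (dus j))).
Qed.

End periodize.

(** * Convergence of the uncertainty product *)

Section limit.
Context {R : realType} {d : nat} (d0 : (0 < d)%N).
Local Open Scope complex_scope.
Local Notation normc := ComplexField.Normc.normc.
Variables (f : 'rV[R]_d -> R[i]) (L : 'rV[R]_d) (beta gamma : R).
Hypotheses (f1 : cC1 f) (dbeta : d%:R < beta) (dgamma : d%:R < gamma)
  (dgamma2 : d%:R / 2 + 1 < gamma)
  (decRe : decays gamma (Re_fun f)) (decIm : decays gamma (Im_fun f))
  (decDRe : forall j, decays beta (rpartial j (Re_fun f)))
  (decDIm : forall j, decays beta (rpartial j (Im_fun f))).

Let a := Re_fun f.
Let b := Im_fun f.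
Let A lam := lattice_sum lam a.
Let B lam := lattice_sum lam b.
Let da y := \sum_j L ord0 j * rpartial j a y.
Let db y := \sum_j L ord0 j * rpartial j b y.
Let DA lam y := \sum_j L ord0 j * lattice_sum lam (rpartial j a) y.
Let DB lam y := \sum_j L ord0 j * lattice_sum lam (rpartial j b) y.
Let theta (y : 'rV[R]_d) : R := 2 * pi * dotp L y.
Let kappa : R := (2 * pi)^-1.

(* In the variable y = lam x, the integrands of |g|^2, lam Im <A g, g>,
   2 lam^2 (|g|^2 - Re <A g, g>), |B g|^2 / lam^2 and <B g, g> / lam for the
   periodization g, each followed by the limit it approximates. *)
Let NN lam y := A lam y * A lam y + B lam y * B lam y.
Let nn y := a y * a y + b y * b y.
Let SS lam y := NN lam y * (1 * lam * sin (theta y / (1 * lam))).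
Let VV lam y := NN lam y *
  ((2 * lam * sin (theta y / (2 * lam))) * (2 * lam * sin (theta y / (2 * lam)))).
Let TT lam y := kappa ^+ 2 * (DA lam y * DA lam y + DB lam y * DB lam y).
Let E1 lam y := kappa * (DA lam y * B lam y + (- 1) * (DB lam y * A lam y)).
Let E2 lam y := kappa * (DA lam y * A lam y + DB lam y * B lam y).

Let apA : approximates gamma A a.
Proof. by apply: (approximates_lattice_sum d0) => //; apply: rC1_continuous; exact: f1.1. Qed.

Let apB : approximates gamma B b.
Proof. by apply: (approximates_lattice_sum d0) => //; apply: rC1_continuous; exact: f1.2. Qed.

Let apDA : approximates beta DA da.
Proof.
apply: approximates_sum => j; apply: approximatesZ; apply: (approximates_lattice_sum d0) => //.
exact: (f1.1 j).2.
Qed.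

Let apDB : approximates beta DB db.
Proof.
apply: approximates_sum => j; apply: approximatesZ; apply: (approximates_lattice_sum d0) => //.
exact: (f1.2 j).2.
Qed.

Let apNN : approximates (gamma + gamma) NN nn.
Proof. by apply: approximatesD; apply: approximatesM. Qed.

Let apSS : approximates (gamma + gamma + - 1) SS (fun y => nn y * theta y).
Proof. by apply: approximatesM => //; exact: approximates_sin. Qed.

Let apVV : approximates (gamma + gamma + (- 1 + - 1)) VV (fun y => nn y * (theta y * theta y)).
Proof. by apply: approximatesM => //; apply: approximatesM; exact: approximates_sin. Qed.

Let apTT : approximates (beta + beta) TT (fun y => kappa ^+ 2 * (da y * da y + db y * db y)).
Proof. by apply: approximatesZ; apply: approximatesD; apply: approximatesM. Qed.

Let apE1 : approximates (beta + gamma) E1 (fun y => kappa * (da y * b y + (- 1) * (db y * a y))).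
Proof.
apply: approximatesZ; apply: approximatesD; first exact: approximatesM.
by apply: approximatesZ; exact: approximatesM.
Qed.

Let apE2 : approximates (beta + gamma) E2 (fun y => kappa * (da y * a y + db y * b y)).
Proof. by apply: approximatesZ; apply: approximatesD; apply: approximatesM. Qed.

Let cellint (U : R -> 'rV[R]_d -> R) lam :=
  \int[lebesgue_rV d]_(x in cell) (lam ^+ d * U lam (lam *: x)).

Let cellint_scale s U u lam (c : R) : approximates s U u -> 1 <= lam ->
  \int[lebesgue_rV d]_(x in cell) (c * (lam ^+ d * U lam (lam *: x))) = c * cellint U lam.
Proof.
move=> ap l1; apply: RintegralZl; first exact: measurable_cell.
exact: approximates_cell_integrable ap l1.
Qed.

Let d_pos : 0 < d%:R :> R. Proof. by rewrite ltr0n. Qed.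

Let g lam := periodize lam f.

Let q_sqr lam : 1 <= lam -> Num.sqrt (lam ^+ d) * Num.sqrt (lam ^+ d) = lam ^+ d :> R.
Proof. by move=> l1; rewrite -expr2 sqr_sqrtr// exprn_ge0// (le_trans _ l1). Qed.

Let Re_g lam x : complex.Re (g lam x) = Num.sqrt (lam ^+ d) * A lam (lam *: x).
Proof. exact: Re_periodize. Qed.

Let Im_g lam x : complex.Im (g lam x) = Num.sqrt (lam ^+ d) * B lam (lam *: x).
Proof. exact: Im_periodize. Qed.

Let g_parts lam : 1 <= lam -> [/\ cC1 (g lam),
  Defs.periodic (Re_fun (g lam)), Defs.periodic (Im_fun (g lam)),
  forall j x, rpartial j (Re_fun (g lam)) x =
    Num.sqrt (lam ^+ d) * (lam * lattice_sum lam (rpartial j a) (lam *: x)) &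
  forall j x, rpartial j (Im_fun (g lam)) x =
    Num.sqrt (lam ^+ d) * (lam * lattice_sum lam (rpartial j b) (lam *: x))].
Proof.
move=> l1; have l0 : 0 < lam by exact: lt_le_trans l1.
pose s := Num.min beta gamma.
have ds : d%:R < s by rewrite /s lt_min dbeta.
have sb : s <= beta by rewrite /s ge_min lexx.
have sg : s <= gamma by rewrite /s ge_min lexx orbT.
have [ra pa da'] := dilated_lattice_sum_rC1 d0 s lam a (Num.sqrt (lam ^+ d)) ds l0 f1.1
  (decays_anti s _ _ sg decRe) (fun j => decays_anti s _ _ sb (decDRe j)).
have [rb pb db'] := dilated_lattice_sum_rC1 d0 s lam b (Num.sqrt (lam ^+ d)) ds l0 f1.2
  (decays_anti s _ _ sg decIm) (fun j => decays_anti s _ _ sb (decDIm j)).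
have eR : Re_fun (g lam) = (fun x => Num.sqrt (lam ^+ d) * lattice_sum lam a (lam *: x)).
  by apply/funext => x; exact: Re_g.
have eI : Im_fun (g lam) = (fun x => Num.sqrt (lam ^+ d) * lattice_sum lam b (lam *: x)).
  by apply/funext => x; exact: Im_g.
by rewrite /cC1 eR eI.
Qed.

Let g_H1 lam : 1 <= lam -> in_H1_Td (g lam).
Proof. by move=> /g_parts[c1 pr pi _ _]; exact: cC1_in_H1_Td. Qed.

Let Re_dg lam x : 1 <= lam -> complex.Re (dderiv cell test_Td L (g lam) x) =
  Num.sqrt (lam ^+ d) * (lam * DA lam (lam *: x)).
Proof.
move=> /g_parts[c1 _ _ dR _]; rewrite Re_dderiv// /DA !mulr_sumr.
by apply: eq_bigr => j _; rewrite dR; ring.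
Qed.

Let Im_dg lam x : 1 <= lam -> complex.Im (dderiv cell test_Td L (g lam) x) =
  Num.sqrt (lam ^+ d) * (lam * DB lam (lam *: x)).
Proof.
move=> /g_parts[c1 _ _ _ dI]; rewrite Im_dderiv// /DB !mulr_sumr.
by apply: eq_bigr => j _; rewrite dI; ring.
Qed.

Let norm_g lam : 1 <= lam -> L2norm cell (g lam) ^+ 2 = cellint NN lam.
Proof.
move=> l1; rewrite L2norm_sqr; apply: eq_Rintegral => x _.
rewrite /Re_fun /Im_fun Re_g Im_g /NN; have := q_sqr _ l1; move: (Num.sqrt (lam ^+ d)) => q <-.
by ring.
Qed.

Let theta_scale lam x : theta (lam *: x) = lam * theta x.
Proof.
rewrite /theta (_ : dotp L (lam *: x) = lam * dotp L x); first by ring.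
by rewrite /dotp mulr_sumr; apply: eq_bigr => j _; rewrite mxE; ring.
Qed.

Let Ag lam x : R[i] := expi (theta x) * g lam x.

(* 1 - cos t = 2 (sin (t / 2))^2 turns the defect from |g|^2 into VV. *)
Let inner_Ag_Re lam : 1 <= lam ->
  complex.Re (L2inner cell (Ag lam) (g lam)) = cellint NN lam - (2 * lam ^+ 2)^-1 * cellint VV lam.
Proof.
move=> l1; have l0 : 0 < lam by exact: lt_le_trans l1.
rewrite -(cellint_scale _ _ _ _ (2 * lam ^+ 2)^-1 apVV l1) /cellint -RintegralB; last 3 first.
- exact: measurable_cell.
- exact: approximates_cell_integrable apNN l1.
- have := approximates_cell_integrable _ _ _ _ ((2 * lam ^+ 2)^-1 * lam ^+ d) apVV l1.
  by congr (integrable _ _ _); apply/funext => x /=; rewrite -[in LHS]mulrA.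
apply: eq_Rintegral => x _.
rewrite /Re_fun Re_mul Re_conj Im_conj /Ag (Re_mul (expi _)) (Im_mul (expi _)) Re_g Im_g /=.
rewrite /VV theta_scale; have := q_sqr _ l1; move: (Num.sqrt (lam ^+ d)) => q <-.
have -> : lam * theta x / (2 * lam) = theta x / 2 by field; rewrite gt_eqF.
have -> : cos (theta x) = 1 - 2 * sin (theta x / 2) ^+ 2.
  rewrite {1}(_ : theta x = (theta x / 2) *+ 2); last by rewrite mulr2n; lra.
  by rewrite cos_mulr2n cos2sin2 mulr2n; ring.
rewrite /NN; field; rewrite gt_eqF//.
Qed.

Let inner_Ag_Im lam : 1 <= lam ->
  complex.Im (L2inner cell (Ag lam) (g lam)) = lam^-1 * cellint SS lam.
Proof.
move=> l1; have l0 : 0 < lam by exact: lt_le_trans l1.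
rewrite -(cellint_scale _ _ _ _ lam^-1 apSS l1).
apply: eq_Rintegral => x _.
rewrite /Im_fun Im_mul Re_conj Im_conj /Ag (Re_mul (expi _)) (Im_mul (expi _)) Re_g Im_g /=.
rewrite /SS theta_scale mul1r; have := q_sqr _ l1; move: (Num.sqrt (lam ^+ d)) => q <-.
have -> : lam * theta x / lam = theta x by field; rewrite gt_eqF.
by rewrite /NN; field; rewrite gt_eqF.
Qed.

Let Bg lam x : R[i] := (0 +i* kappa) * dderiv cell test_Td L (g lam) x.

Let norm_Bg lam : 1 <= lam -> L2norm cell (Bg lam) ^+ 2 = lam ^+ 2 * cellint TT lam.
Proof.
move=> l1; rewrite -(cellint_scale _ _ _ _ _ apTT l1) L2norm_sqr; apply: eq_Rintegral => x _.
rewrite /Re_fun /Im_fun /Bg (Re_mul (0 +i* kappa)) (Im_mul (0 +i* kappa)) Re_dg// Im_dg//= /TT.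
have := q_sqr _ l1; move: (Num.sqrt (lam ^+ d)) => q <-.
by ring.
Qed.

Let inner_Bg_Re lam : 1 <= lam ->
  complex.Re (L2inner cell (Bg lam) (g lam)) = lam * cellint E1 lam.
Proof.
move=> l1; rewrite -(cellint_scale _ _ _ _ _ apE1 l1); apply: eq_Rintegral => x _.
rewrite /Re_fun Re_mul Re_conj Im_conj /Bg (Re_mul (0 +i* kappa)) (Im_mul (0 +i* kappa))
    Re_dg// Im_dg// Re_g Im_g /=.
rewrite /E1; have := q_sqr _ l1; move: (Num.sqrt (lam ^+ d)) => q <-.
by ring.
Qed.

Let inner_Bg_Im lam : 1 <= lam ->
  complex.Im (L2inner cell (Bg lam) (g lam)) = lam * cellint E2 lam.
Proof.
move=> l1; rewrite -(cellint_scale _ _ _ _ _ apE2 l1); apply: eq_Rintegral => x _.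
rewrite /Im_fun Im_mul Re_conj Im_conj /Bg (Re_mul (0 +i* kappa)) (Im_mul (0 +i* kappa))
    Re_dg// Im_dg// Re_g Im_g /=.
rewrite /E2; have := q_sqr _ l1; move: (Num.sqrt (lam ^+ d)) => q <-.
by ring.
Qed.

Let m := \int[lebesgue_rV d]_y nn y.
Let v := \int[lebesgue_rV d]_y (nn y * (theta y * theta y)).
Let w := \int[lebesgue_rV d]_y (nn y * theta y).
Let t := \int[lebesgue_rV d]_y (kappa ^+ 2 * (da y * da y + db y * db y)).
Let e1 := \int[lebesgue_rV d]_y (kappa * (da y * b y + (- 1) * (db y * a y))).
Let e2 := \int[lebesgue_rV d]_y (kappa * (da y * a y + db y * b y)).

Let norm_f : L2norm setT f ^+ 2 = m.
Proof. exact: L2norm_sqr. Qed.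

Let norm_Af : L2norm setT (opA L f) ^+ 2 = v.
Proof.
rewrite L2norm_sqr; apply: eq_Rintegral => x _.
by rewrite /Re_fun /Im_fun /opA Re_real_mul Im_real_mul /nn /a /b /Re_fun /Im_fun /theta; ring.
Qed.

Let inner_Af_Re : complex.Re (L2inner setT (opA L f) f) = w.
Proof.
apply: eq_Rintegral => x _.
rewrite /Re_fun Re_mul Re_conj Im_conj /opA Re_real_mul Im_real_mul.
by rewrite /nn /a /b /Re_fun /Im_fun /theta; ring.
Qed.

Let inner_Af_Im : complex.Im (L2inner setT (opA L f) f) = 0.
Proof.
transitivity (\int[lebesgue_rV d]_(x in setT) (0 : R)); last by rewrite Rintegral_cst// mul0r.
apply: eq_Rintegral => x _.
by rewrite /Im_fun Im_mul Re_conj Im_conj /opA Re_real_mul Im_real_mul; ring.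
Qed.

Let norm_Bf : L2norm setT (opB L f) ^+ 2 = t.
Proof.
rewrite L2norm_sqr; apply: eq_Rintegral => x _.
rewrite /Re_fun /Im_fun /opB (Re_mul (0 +i* _)) (Im_mul (0 +i* _)) Re_dderiv// Im_dderiv//=.
by rewrite /da /db /kappa; ring.
Qed.

Let inner_Bf_Re : complex.Re (L2inner setT (opB L f) f) = e1.
Proof.
apply: eq_Rintegral => x _; rewrite /Re_fun Re_mul Re_conj Im_conj /opB.
rewrite (Re_mul (0 +i* _)) (Im_mul (0 +i* _)) Re_dderiv// Im_dderiv//=.
by rewrite /da /db /kappa /a /b /Re_fun /Im_fun; ring.
Qed.

Let inner_Bf_Im : complex.Im (L2inner setT (opB L f) f) = e2.
Proof.
apply: eq_Rintegral => x _; rewrite /Im_fun Im_mul Re_conj Im_conj /opB.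
rewrite (Re_mul (0 +i* _)) (Im_mul (0 +i* _)) Re_dderiv// Im_dderiv//=.
by rewrite /da /db /kappa /a /b /Re_fun /Im_fun; ring.
Qed.

Let lt_sum (D x y : R) : 0 < D -> D < x -> D < y -> D < x + y.
Proof. lra. Qed.

Let lt_sum1 (D x : R) : D / 2 + 1 < x -> D < x + x + - 1.
Proof. lra. Qed.

Let lt_sum2 (D x : R) : D / 2 + 1 < x -> D < x + x + (- 1 + - 1).
Proof. lra. Qed.

Let limM : cellint NN lam @[lam --> +oo] --> m.
Proof. apply: (approximates_integral d0 _ _ _ _ apNN); exact: lt_sum. Qed.

Let limV : cellint VV lam @[lam --> +oo] --> v.
Proof. apply: (approximates_integral d0 _ _ _ _ apVV); exact: lt_sum2. Qed.

Let limW : cellint SS lam @[lam --> +oo] --> w.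
Proof. apply: (approximates_integral d0 _ _ _ _ apSS); exact: lt_sum1. Qed.

Let limT : cellint TT lam @[lam --> +oo] --> t.
Proof. apply: (approximates_integral d0 _ _ _ _ apTT); exact: lt_sum. Qed.

Let limE1 : cellint E1 lam @[lam --> +oo] --> e1.
Proof. apply: (approximates_integral d0 _ _ _ _ apE1); exact: lt_sum. Qed.

Let limE2 : cellint E2 lam @[lam --> +oo] --> e2.
Proof. apply: (approximates_integral d0 _ _ _ _ apE2); exact: lt_sum. Qed.

Let cvg_inv : lam^-1 @[lam --> +oo] --> (0 : R).
Proof.
apply/cvgrPdist_lt => e e0; near=> lam.
have l0 : 0 < lam by near: lam; exact: nbhs_pinfty_gt.
rewrite sub0r normrN gtr0_norm ?invr_gt0// invf_plt ?posrE//.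
by near: lam; apply: nbhs_pinfty_gt; rewrite num_real.
Unshelve. all: by end_near. Qed.

(* The real part of <A g, g>. *)
Let cc lam := cellint NN lam - 2^-1 * (lam^-1 * lam^-1) * cellint VV lam.

Let cvg_cc : cc lam @[lam --> +oo] --> m.
Proof.
have -> : m = m - 2^-1 * (0 * 0) * v by ring.
apply: cvgB; first exact: limM.
apply: cvgM; last exact: limV.
by apply: cvgM; [exact: cvg_cst|exact: (cvgM cvg_inv cvg_inv)].
Qed.

Hypothesis m_gt0 : 0 < m.

Let near_cc : \forall lam \near +oo, 0 < cc lam.
Proof. exact: (cvgr_gt _ cvg_cc). Qed.

Lemma periodized_UP_defined : \forall lam \near +oo, in_H1_Td (g lam) /\
  L2inner cell (Ag lam) (g lam) != 0.
Proof.
near=> lam.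
have l1 : 1 <= lam by near: lam; apply: nbhs_pinfty_ge; rewrite num_real.
split; first exact: g_H1.
apply/eqP => /(congr1 (@complex.Re R)); rewrite inner_Ag_Re//=.
have : 0 < cc lam by near: lam.
have -> : cc lam = cellint NN lam - (2 * lam ^+ 2)^-1 * cellint VV lam.
  by rewrite /cc expr2 !invfM.
by move=> h e; move: h; rewrite e ltxx.
Unshelve. all: by end_near. Qed.

(** Write M = |g|^2 and <A g, g> = c + i s.  The factor M^2 / (c^2 + s^2) - 1 is
    of order lam^-2 and the factor built from B g of order lam^2, since
    lam^2 (M^2 - c^2 - s^2) = lam^2 (M - c) (M + c) - (lam s)^2 converges. *)
Lemma periodized_UP_cvg :
  1 / enorm L ^+ 4
  * (L2norm cell (g lam) ^+ 4 / normc (L2inner cell (Ag lam) (g lam)) ^+ 2 - 1)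
  * (L2norm cell (Bg lam) ^+ 2 / L2norm cell (g lam) ^+ 2
     - normc (L2inner cell (Bg lam) (g lam)) ^+ 2 / L2norm cell (g lam) ^+ 4)
  @[lam --> +oo] --> UP L f.
Proof.
pose P lam := cellint VV lam * (cellint NN lam + cc lam) * 2^-1 - cellint SS lam * cellint SS lam.
pose Q lam := cc lam * cc lam + (lam^-1 * cellint SS lam) * (lam^-1 * cellint SS lam).
pose S lam := cellint TT lam * (cellint NN lam)^-1 -
  (cellint E1 lam * cellint E1 lam + cellint E2 lam * cellint E2 lam) * ((cellint NN lam)^-1 *
      (cellint NN lam)^-1).
have m0 : m != 0 by rewrite gt_eqF.
have cP : P lam @[lam --> +oo] --> v * (m + m) * 2^-1 - w * w.
  apply: cvgB; last exact: (cvgM limW limW).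
  apply: cvgM; last exact: cvg_cst.
  by apply: cvgM; [exact: limV|exact: (cvgD limM cvg_cc)].
have cQ : Q lam @[lam --> +oo] --> m * m + (0 * w) * (0 * w).
  apply: cvgD; first exact: (cvgM cvg_cc cvg_cc).
  by apply: cvgM; exact: (cvgM cvg_inv limW).
have cMi : (cellint NN lam)^-1 @[lam --> +oo] --> m^-1 by exact: (cvgV m0 limM).
have cS : S lam @[lam --> +oo] --> t * m^-1 - (e1 * e1 + e2 * e2) * (m^-1 * m^-1).
  apply: cvgB; first exact: (cvgM limT cMi).
  apply: cvgM; last exact: (cvgM cMi cMi).
  exact: (cvgD (cvgM limE1 limE1) (cvgM limE2 limE2)).
have Q0 : m * m + (0 * w) * (0 * w) != 0.
  by rewrite !mul0r addr0 mulf_neq0.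
have UPE : UP L f = 1 / enorm L ^+ 4 * ((v * (m + m) * 2^-1 - w * w) *
    (m * m + (0 * w) * (0 * w))^-1) * (t * m^-1 - (e1 * e1 + e2 * e2) * (m^-1 * m^-1)).
  rewrite /UP /Delta norm_Af norm_Bf norm_f !normc_sqr inner_Af_Re inner_Af_Im
    inner_Bf_Re inner_Bf_Im (exprM (L2norm setT f) 2 2) norm_f !mul0r addr0.
  rewrite invfM div1r; move: (enorm L ^+ 4)^-1 => l4.
  by field.
rewrite UPE.
have lim : 1 / enorm L ^+ 4 * (P lam * (Q lam)^-1) * S lam @[lam --> +oo] -->
    1 / enorm L ^+ 4 * ((v * (m + m) * 2^-1 - w * w) *
    (m * m + (0 * w) * (0 * w))^-1) * (t * m^-1 - (e1 * e1 + e2 * e2) * (m^-1 * m^-1)).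
  apply: cvgM; last exact: cS.
  apply: cvgM; first exact: cvg_cst.
  exact: (cvgM cP (cvgV Q0 cQ)).
apply: cvg_trans lim; apply: near_eq_cvg; near=> lam.
have l1 : 1 <= lam by near: lam; apply: nbhs_pinfty_ge; rewrite num_real.
have l0 : lam != 0 by rewrite gt_eqF// (lt_le_trans _ l1).
have c0 : cc lam != 0 by rewrite gt_eqF//; near: lam.
have M0 : cellint NN lam != 0.
  by rewrite gt_eqF//; near: lam; exact: (cvgr_gt _ limM).
rewrite (exprM (L2norm cell (g lam)) 2 2) norm_g// norm_Bg// !normc_sqr inner_Ag_Re// inner_Ag_Im//
  inner_Bg_Re// inner_Bg_Im//.
have -> : cellint NN lam - (2 * lam ^+ 2)^-1 * cellint VV lam = cc lam.
  by rewrite /cc expr2 !invfM.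
have QQ : Q lam != 0.
  rewrite gt_eqF// ltr_pwDl//; last by rewrite -expr2 sqr_ge0.
  by rewrite -expr2 exprn_even_gt0.
rewrite -/(Q lam).
have -> : cellint NN lam ^+ 2 / Q lam - 1 = lam^-1 * lam^-1 * (P lam * (Q lam)^-1).
  rewrite -[X in _ - X](divff QQ) -mulrBl mulrA; congr (_ / _).
  by rewrite /P /Q /cc; field.
rewrite /S; move: (1 / _) => l4; field.
by rewrite QQ M0 l0.
Unshelve. all: by end_near. Qed.

End limit.

(** * Admissible functions *)

Section admissible.
Context {R : realType} {d : nat} (d0 : (0 < d)%N).
Local Notation normc := ComplexField.Normc.normc.
Implicit Types f : 'rV[R]_d -> R[i].

Lemma normc_decay f (s : R) : decays s (Re_fun f) -> decays s (Im_fun f) ->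
  exists2 K, 0 <= K & forall x, normc (f x) ^+ 2 <= K * wt (s + s) x.
Proof.
move=> [K uK] [M uM]; exists (K * K + M * M) => [|x].
  by rewrite addr_ge0// -expr2 sqr_ge0.
rewrite normc_sqr mulrDl wtD lerD// -expr2 -[leLHS]ger0_norm ?sqr_ge0// expr2 normrM mulrACA.
  by rewrite ler_pM// uK.
by rewrite ler_pM// uM.
Qed.

Lemma normc_sqr_measurable f : cC1 f ->
  measurable_fun [set: 'rV[R]_d] (fun x => normc (f x) ^+ 2).
Proof.
move=> [f1 f2].
rewrite (_ : (fun x => _) = (fun x => Re_fun f x * Re_fun f x + Im_fun f x * Im_fun f x)); last
    first.
  by apply/funext => x; rewrite normc_sqr.
apply: continuous_measurable_rV; apply: continuous_addf; apply: continuous_mulf; exact: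
    rC1_continuous.
Qed.

Lemma weighted_decay_domA f (s : R) : cC1 f -> in_L2 setT f -> d%:R / 2 + 1 < s ->
  decays s (Re_fun f) -> decays s (Im_fun f) -> domA f.
Proof.
move=> f1 f2 ds dr di; split => //.
have [K K0 HK] := normc_decay f s dr di.
have ds2 : d%:R < s + s + (- 1 + - 1).
  have H (D : R) : D / 2 + 1 < s -> D < s + s + (- 1 + - 1) by lra.
  exact: H.
have iw := integrableZl measurableT (d%:R * K) (wt_integrable d0 _ ds2).
have /integrableP[mw] := iw; apply: le_lt_trans; apply: ge0_le_integral => //.
- by move=> x _; rewrite lee_fin mulr_ge0// sqr_ge0.
- apply/measurable_EFinP; apply: measurable_funM; last exact: normc_sqr_measurable.
  apply: continuous_measurable_rV.
  have -> : (fun x : 'rV[R]_d => enorm x ^+ 2) = (fun x => \sum_(j < d) x ord0 j * x ord0 j).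
    apply/funext => x; rewrite sqr_sqrtr//; apply: sumr_ge0 => i _.
    by rewrite -expr2 sqr_ge0.
  rewrite /index_enum; elim: (locked_with _ _) => [|j r IH].
    by under eq_fun do rewrite big_nil; move=> y; exact: cst_continuous.
  under eq_fun do rewrite big_cons; apply: continuous_addf => //.
  by apply: continuous_mulf => y; exact: coord_continuous.
- exact: measurableT_comp.
- move=> x _ /=; rewrite lee_fin.
  apply: le_trans (ler_norm _).
  apply: (@le_trans _ _ ((d%:R * `|x| ^+ 2) * (K * wt (s + s) x))).
    by rewrite ler_pM ?sqr_ge0// enorm_sqr_le.
  have hX : `|x| ^+ 2 <= wt (- 1 + - 1) x.
    rewrite wtD /wt opprK powRr1 ?addr_ge0// -expr2.
    by rewrite lerXn2r ?nnegrE ?addr_ge0// lerDr.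
  have -> : wt (s + s + (- 1 + - 1)) x = wt (s + s) x * wt (- 1 + - 1) x by exact: wtD.
  rewrite (_ : d%:R * K * _ = d%:R * wt (- 1 + - 1) x * (K * wt (s + s) x)); last by ring.
  by rewrite ler_wpM2r ?mulr_ge0 ?wt_ge0// ler_wpM2l.
Qed.

Lemma nonzero_mass_gt0 f : cC1 f -> in_L2 setT f -> nonzero f ->
  0 < \int[lebesgue_rV d]_x (Re_fun f x * Re_fun f x + Im_fun f x * Im_fun f x).
Proof.
move=> f1 [_ _ fint] fn0; rewrite lt_neqAle; apply/andP; split; last first.
  by apply: Rintegral_ge0 => x _; rewrite -!expr2 addr_ge0 ?sqr_ge0.
apply/negP => /eqP e0; apply: fn0.
have mf := normc_sqr_measurable f f1.
have e : (\int[lebesgue_rV d]_x `|(normc (f x) ^+ 2)%:E| = 0)%E.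
  have e1 : (\int[lebesgue_rV d]_x `|(normc (f x) ^+ 2)%:E| = \int[lebesgue_rV d]_x (normc (f
      x) ^+ 2)%:E)%E.
    by apply: eq_integral => x _; rewrite gee0_abs// lee_fin sqr_ge0.
  rewrite e1 -[LHS]fineK; last first.
    by rewrite ge0_fin_numE//; apply: integral_ge0 => x _; rewrite lee_fin sqr_ge0.
  congr EFin; rewrite [RHS]e0; apply: eq_Rintegral => x _; exact: normc_sqr.
have mE : measurable_fun [set: 'rV[R]_d] (fun x => (normc (f x) ^+ 2)%:E).
  exact/measurable_EFinP.
have [H _] := ae_eq_integral_abs (lebesgue_rV d) measurableT mE.
apply: filterS (H e) => x /(_ I) /= [] /eqP.
by rewrite sqrf_eq0 => /eqP; exact: ComplexField.Normc.eq0_normc.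
Qed.

End admissible.

Theorem theorem5 (R : realType) (d : nat) (f : 'rV[R]_d -> R[i])
    (L : 'rV[int]_d) (hf : admissible f) (hL : L != 0) :
  UP_defined f /\
  (\forall lambda \near +oo, UP_Td_defined L (periodize lambda f)) /\
  UP_Td L (periodize lambda f) @[lambda --> +oo] --> UP (rV_of_int L) f.
Proof.
have d0 : (0 < d)%N.
  case: (posnP d) => // dE; case/eqP: hL; apply/rowP => i.
  by exfalso; move: i; rewrite dE; case.
case: hf => -[fn0 fL2] f1 fH1 _ [C1 [C2 [beta [gamma [[C10 C20] dbeta]]]]].
rewrite gt_max => /andP[dgamma2 dgamma] fdec dfdec.
have gamma0 : 0 <= gamma by rewrite (le_trans _ (ltW dgamma)).
have beta0 : 0 <= beta by rewrite (le_trans _ (ltW dbeta)).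
have decRe : decays gamma (Re_fun f).
  apply: (decays_of_power_decay _ C1) => //; first exact: ltW.
    by apply: rC1_continuous; exact: f1.1.
  by move=> x x0; apply: le_trans (fdec x x0); exact: norm_Re_le.
have decIm : decays gamma (Im_fun f).
  apply: (decays_of_power_decay _ C1) => //; first exact: ltW.
    by apply: rC1_continuous; exact: f1.2.
  by move=> x x0; apply: le_trans (fdec x x0); exact: norm_Im_le.
have decDRe j : decays beta (rpartial j (Re_fun f)).
  apply: (decays_of_power_decay _ C2) => //; first exact: ltW.
    exact: (f1.1 j).2.
  move=> x x0; apply: le_trans (dfdec j x x0).
  exact: (norm_Re_le (cpartial j f x)).
have decDIm j : decays beta (rpartial j (Im_fun f)).
  apply: (decays_of_power_decay _ C2) => //; first exact: ltW.
    exact: (f1.2 j).2.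
  move=> x x0; apply: le_trans (dfdec j x x0).
  exact: (norm_Im_le (cpartial j f x)).
have mass := nonzero_mass_gt0 f f1 fL2 fn0.
split; first by split => //; exact: (weighted_decay_domA d0 f gamma).
split.
  exact: (periodized_UP_defined d0 f (rV_of_int L) beta gamma).
exact: (periodized_UP_cvg d0 f (rV_of_int L) beta gamma).
Qed.
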